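(* There is a universal constant $\alpha>0$ such that for infinitely many positive integers $n$ (for which $U_{n,\lceil \sqrt n \rceil}$ is defined), any two-party communication protocol that computes $\mathsf{EGH}_{n}$ over inputs from $U_{n,\lceil \sqrt n \rceil}$ with success probability $2/3$ must have communication complexity at least $\alpha n$.
   Context: For positive integers $n,k$, the exact gap-hamming function $\mathsf{EGH}_{n,k}:\{\pm1\}^n\times\{\pm1\}^n\to\{0,1,\star\}$ is defined by $\mathsf{EGH}_{n,k}(x,y)=1$ if $\langle x,y\rangle=k$, $\mathsf{EGH}_{n,k}(x,y)=0$ if $\langle x,y\rangle=-k$, and $\mathsf{EGH}_{n,k}(x,y)=\star$ otherwise, where $\langle x,y\rangle=\sum_j x_jy_j$. Write $\mathsf{EGH}_n=\mathsf{EGH}_{n,\lceil\sqrt n\rceil}$. $U_{n,k}$ denotes the uniform distribution over the set of pairs $(x,y) \in \{\pm 1\}^n \times \{\pm 1\}^n$ with $\langle x,y\rangle \in \{k,-k\}$ (defined when this set is non-empty). Protocols are in the standard two-party communication model: Alice gets $x$, Bob gets $y$, they exchange bits, the output is determined by the transcript, and the communication complexity of the protocol is the maximal number of bits exchanged. A protocol computes $\mathsf{EGH}_{n,k}$ over inputs from $U_{n,k}$ with success probability $2/3$ if, when $(x,y)$ is sampled from $U_{n,k}$, the output equals $\mathsf{EGH}_{n,k}(x,y)$ with probability at least $2/3$ (over the input and any randomness of the protocol). *)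

(* Defs.v *)
From HB Require Import structures.
From mathcomp Require Import all_boot all_order all_algebra.
From mathcomp Require Import all_classical all_reals all_analysis.

Set Implicit Arguments.
Unset Strict Implicit.
Unset Printing Implicit Defensive.

Import Order.TTheory GRing.Theory Num.Theory.

Local Open Scope classical_set_scope.
Local Open Scope ring_scope.

(* {-1, 1}^n, with the boolean b standing for the sign (-1) ^+ b *)
Definition signvec (n : nat) : finType := {ffun 'I_n -> bool}.

Definition sgn_coord (n : nat) (x : signvec n) (j : 'I_n) : int := (-1) ^+ x j.

Definition inner (n : nat) (x y : signvec n) : int :=
  \sum_(j < n) sgn_coord x j * sgn_coord y j.

(* The codomain {0, 1, star} is option bool, None being star. The parameter k
   is meant to be positive. *)
Definition EGH (n k : nat) (x y : signvec n) : option bool :=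
  if inner x y == k%:Z then Some true
  else if inner x y == - k%:Z then Some false
  else None.

(* Num.ceil is int-valued; it is nonnegative here, so absz loses nothing *)
Definition ceil_sqrt (R : realType) (n : nat) : nat :=
  `|Num.ceil (Num.sqrt (n%:R : R))|%N.

Definition U_supp (n k : nat) : {set signvec n * signvec n} :=
  [set xy : signvec n * signvec n |
     (inner xy.1 xy.2 == k%:Z) || (inner xy.1 xy.2 == - k%:Z)]%SET.

(* Probability mass function of U_{n,k}; it is a probability distribution only
   when U_supp n k is nonempty. *)
Definition U_pmf (R : realType) (n k : nat) (xy : signvec n * signvec n) : R :=
  if xy \in U_supp n k then (#|U_supp n k|%:R)^-1 else 0.

(* Deterministic protocol trees: the speaker at a node sends the bit computed
   from its own input, and the play continues in the first subtree if the bit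
   is true, in the second one otherwise. The node reached, hence the speaker,
   the remaining play and the output, is determined by the transcript. *)
Inductive protocol (X Y Z : Type) : Type :=
| Output of Z
| Alice of (X -> bool) & protocol X Y Z & protocol X Y Z
| Bob of (Y -> bool) & protocol X Y Z & protocol X Y Z.

Fixpoint output (X Y Z : Type) (p : protocol X Y Z) (x : X) (y : Y) : Z :=
  match p with
  | Output z => z
  | Alice f p1 p0 => if f x then output p1 x y else output p0 x y
  | Bob g p1 p0 => if g y then output p1 x y else output p0 x y
  end.

Fixpoint bits (X Y Z : Type) (p : protocol X Y Z) (x : X) (y : Y) : nat :=
  match p with
  | Output _ => 0%N
  | Alice f p1 p0 => (if f x then bits p1 x y else bits p0 x y).+1
  | Bob g p1 p0 => (if g y then bits p1 x y else bits p0 x y).+1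
  end.

(* Randomized protocols, with coins drawn from an arbitrary probability space
   T and visible to both parties. Private coins, and private together with
   public coins, are the special case where T is a product and each party only
   uses its own components. Deterministic protocols are the constant maps. *)
Record rprotocol (d : measure_display) (T : measurableType d)
    (X Y Z : Type) : Type := RProtocol {
  rp_tree :> T -> protocol X Y Z;
  rp_measurable : forall (x : X) (y : Y) (z : Z),
    measurable [set w : T | output (rp_tree w) x y = z]
}.

(* Supremum over inputs and coins; +oo if there is no uniform bound. *)
Definition comm_complexity (R : realType) (d : measure_display)
    (T : measurableType d) (X Y Z : Type) (p : rprotocol T X Y Z) : \bar R :=
  ereal_sup [set e : \bar R | exists w x y, e = ((bits (p w) x y)%:R)%:E].

(* Probability of a correct output when (x, y) is drawn from U_{n,k} and,
   independently, the coins from P. *)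
Definition success_prob (R : realType) (d : measure_display)
    (T : measurableType d) (P : probability T R) (n k : nat)
    (p : rprotocol T (signvec n) (signvec n) (option bool)) : R :=
  \sum_(xy : signvec n * signvec n)
    U_pmf R k xy *
      fine (P [set w : T | output (p w) xy.1 xy.2 = EGH k xy.1 xy.2]).

(* Main.v *)
Require Import Defs.
From mathcomp Require Import all_boot all_order all_algebra all_fingroup.
From mathcomp Require Import all_classical all_reals all_analysis.
From mathcomp Require Import measurable_realfun ring lra zify.

Set Implicit Arguments.
Unset Strict Implicit.
Unset Printing Implicit Defensive.

Import Order.TTheory GRing.Theory Num.Theory.

Local Open Scope classical_set_scope.
Local Open Scope ring_scope.

(* Let E be the even-weight vectors of {-1, 1}^N, k' = 4 s and N = r^2 k'^2 for a
   large constant r. The heart of the matter is that on every rectangle A x B inside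
   E x E the values k' and - k' of the inner product are hit almost equally often:
   the difference is O(k' / N) |A| |B| plus an exponentially small part of 4^N.
   Fourier inversion writes this difference as an average over th of
   sin (k' th) * sum_{A x B} sin (th <x, y>), so it suffices that the bilinear sum
   decays like exp (- c N th^2) when the densities of A and B multiply to at least
   (9/10)^N.
   This follows from Hoelder and the tensorized moment inequality
   sum_x |sum_{y in B} e^(i th <x, y>)|^(2m) <= (16/5)^N |B|^(2m-1), m ~ 1 / th^2,
   whose one-coordinate case is an entropy inequality; 16/5 < 4 is the gain.

   A protocol with few bits splits E x E into few rectangles, so it accepts the pairs
   at level k' about as often as those at level - k'. Repeating every coordinate
   t = r^2 times and applying a random permutation and random signs turns a pair at
   level k' into a uniform pair of vectors of length n = t N at level
   t k' = sqrt n, and the repetition makes the error O(k' / sqrt N) = O(1 / r) of the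
   rectangle bound beat the advantage 1/3 of a protocol for U_{n, sqrt n}. *)

(** * Two-point inequality *)

Lemma ln_le_subr1 (R : realType) (x : R) : 0 < x -> ln x <= x - 1.
Proof.
move=> x0; have -> : ln x = ln (1 + (x - 1)) by rewrite addrC subrK.
by apply: le_ln1Dx; rewrite ltrBrDr addNr.
Qed.

(** Termwise form of the nonnegativity of relative entropy, from ln y <= y - 1 at y = s / a. Over
    two probability vectors the left sides add up to 0. *)
Lemma mulr_ln_ge (R : realType) (a s : R) : 0 < a -> 0 < s -> a - s <= a * ln (a / s).
Proof.
move=> a0 s0; have h : - ln (a / s) <= s / a - 1.
  by rewrite -lnV ?posrE ?divr_gt0// invf_div ln_le_subr1 ?divr_gt0.
have := ler_wpM2l (ltW a0) h.
rewrite mulrBr mulrCA divff ?gt_eqF// !mulr1 mulrN; lra.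
Qed.

(** The right side is the relative entropy of (a, b) with respect to the uniform law, so this is
    Pinsker's inequality with a weaker constant. The logarithm is removed by x ln (2 x) >= 2 x -
    sqrt (2 x). *)
Lemma entropy_ge (R : realType) (a b : R) : 0 < a -> 0 < b -> a + b = 1 ->
  (a - b) ^+ 2 / 4 <= a * ln (2 * a) + b * ln (2 * b).
Proof.
move=> a0 b0 ab.
have key (x : R) : 0 < x -> 2 * x - Num.sqrt (2 * x) <= x * ln (2 * x).
  move=> x0; set w := Num.sqrt (2 * x).
  have w0 : 0 < w by rewrite sqrtr_gt0 mulr_gt0.
  have ww : w * w = 2 * x by rewrite -expr2 sqr_sqrtr// mulr_ge0// ltW.
  have := @mulr_ln_ge R w 1 w0 ltr01; rewrite divr1 -ww lnM ?posrE// => h.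
  have -> : x = w * w / 2 by rewrite ww; field.
  nra.
have := key a a0; have := key b b0.
set u := Num.sqrt (2 * a); set w := Num.sqrt (2 * b).
have u0 : 0 <= u by rewrite sqrtr_ge0.
have w0 : 0 <= w by rewrite sqrtr_ge0.
have uu : u ^+ 2 = 2 * a by rewrite sqr_sqrtr// mulr_ge0// ltW.
have ww : w ^+ 2 = 2 * b by rewrite sqr_sqrtr// mulr_ge0// ltW.
move=> h1 h2.
(* The two instances of [key] add up to the lower bound 2 - (u + w). *)
suff : u + w <= 2 - (a - b) ^+ 2 / 4 by lra.
have -> : a - b = (u ^+ 2 - w ^+ 2) / 2 by rewrite uu ww; field.
have e : u ^+ 2 + w ^+ 2 = 2 by rewrite uu ww; lra.
set p := u + w.
have p0 : 0 <= p by rewrite addr_ge0.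
have dd : (u - w) ^+ 2 = 4 - p ^+ 2.
  have -> : (u - w) ^+ 2 = 2 * (u ^+ 2 + w ^+ 2) - p ^+ 2 by rewrite /p; ring.
  by rewrite e; ring.
have p2 : p <= 2.
  have : 0 <= (u - w) ^+ 2 by exact: sqr_ge0.
  by rewrite dd subr_ge0 (_ : 4 = 2 ^+ 2 :> R) ?ler_pXn2r ?nnegrE//; ring.
have -> : ((u ^+ 2 - w ^+ 2) / 2) ^+ 2 / 4 = (2 - p) * (p ^+ 2 * (2 + p) / 16).
  rewrite (_ : _ / 4 = p ^+ 2 * (u - w) ^+ 2 / 16); last by rewrite /p; field.
  by rewrite dd; field.
have h3 : p ^+ 2 * (2 + p) / 16 <= 1 by nra.
have := ler_wpM2l (_ : 0 <= 2 - p) h3; rewrite subr_ge0 => /(_ p2); lra.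
Qed.

(** The bound X >= 1 + ln X turns powers into entropies. The terms with factor k add up to at least
    0 whatever s and t are, and [entropy_ge] treats the rest; hence a bound free of k. *)
Lemma entropy_power_ge (R : realType) (a b s t : R) (k : nat) :
  0 < a -> 0 < b -> a + b = 1 -> 0 < s -> 0 < t -> s + t = 1 ->
  (1 + (a - b) ^+ 2 / 4) / 2 <= a ^+ 2 * (a / s) ^+ k + b ^+ 2 * (b / t) ^+ k.
Proof.
move=> a0 b0 ab s0 t0 st.
have key (x y : R) : 0 < x -> 0 < y ->
    x * (1 + ln (2 * x)) + k%:R * (x - y) <= 2 * (x ^+ 2 * (x / y) ^+ k).
  move=> x0 y0; have xy : 0 < x / y by rewrite divr_gt0.
  set X := 2 * x * (x / y) ^+ k.
  have X0 : 0 < X by rewrite !mulr_gt0// exprn_gt0.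
  have -> : 2 * (x ^+ 2 * (x / y) ^+ k) = x * X by rewrite /X; ring.
  have h : 1 + ln X <= X.
    by have := ln_le_subr1 X0; lra.
  have e : ln X = ln (2 * x) + k%:R * ln (x / y).
    rewrite /X lnM ?posrE ?mulr_gt0 ?exprn_gt0//; congr (_ + _).
    by rewrite lnXn// mulr_natl.
  have := ler_wpM2l (ltW x0) h; rewrite e.
  have := ler_wpM2l (ler0n R k) (mulr_ln_ge x0 y0).
  nra.
have := key a s a0 s0; have := key b t b0 t0; have := entropy_ge a0 b0 ab.
have : k%:R * (a - s) + k%:R * (b - t) = 0 :> R.
  by rewrite -mulrDr (_ : _ + _ = 0) ?mulr0//; lra.
lra.
Qed.

Lemma power_mean_ge (R : realType) (a b s t : R) (k : nat) :
  0 <= a -> 0 <= b -> 0 < s -> 0 < t ->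
  (a + b) ^+ k.+2 * (1 + (a - b) ^+ 2 / (a + b) ^+ 2 / 4) / 2 <=
    (s + t) ^+ k * (a ^+ k.+2 / s ^+ k + b ^+ k.+2 / t ^+ k).
Proof.
have edge (x y z : R) : 0 <= x -> 0 < y -> 0 < z ->
    x ^+ k.+2 * (1 + x ^+ 2 / x ^+ 2 / 4) / 2 <= (y + z) ^+ k * (x ^+ k.+2 / y ^+ k).
  move=> x0 y0 z0; rewrite mulrCA -mulrA ler_wpM2l ?exprn_ge0//.
  have h : 1 <= (y + z) ^+ k / y ^+ k.
    by rewrite ler_pdivlMr ?exprn_gt0// mul1r lerXn2r// ?nnegrE; lra.
  apply: le_trans h; have [->|xn0] := eqVneq x 0.
    by rewrite expr0n/= mul0r mul0r; lra.
  by rewrite divff ?expf_neq0//; lra.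
move=> a0 b0 s0 t0.
have [->|an0] := eqVneq a 0.
  rewrite !add0r sqrrN [0 ^+ k.+2]expr0n/= mul0r add0r (addrC s).
  exact: edge.
have [->|bn0] := eqVneq b 0.
  by rewrite !addr0 subr0 [0 ^+ k.+2]expr0n/= mul0r addr0; exact: edge.
have {an0}a0 : 0 < a by rewrite lt_def an0.
have {bn0}b0 : 0 < b by rewrite lt_def bn0.
have ab0 : 0 < a + b by rewrite addr_gt0.
have st0 : 0 < s + t by rewrite addr_gt0.
have abn : a + b != 0 by rewrite gt_eqF.
have stn : s + t != 0 by rewrite gt_eqF.
have := @entropy_power_ge R (a / (a + b)) (b / (a + b)) (s / (s + t)) (t / (s + t)) k.
rewrite !divr_gt0// -!mulrDl !divff// => /(_ isT isT erefl isT isT erefl) h.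
have := ler_wpM2l (exprn_ge0 k.+2 (ltW ab0)) h; rewrite mulrA.
rewrite -mulrBl exprMn exprVn => /le_trans; apply.
have e (x y : R) : 0 < y -> (a + b) ^+ k.+2 *
    ((x / (a + b)) ^+ 2 * (x / (a + b) / (y / (s + t))) ^+ k) =
    (s + t) ^+ k * (x ^+ k.+2 / y ^+ k).
  move=> y0; have yk : y ^+ k != 0 by rewrite expf_neq0 ?gt_eqF.
  have abk : (a + b) ^+ k != 0 by rewrite expf_neq0.
  have stk : (s + t) ^+ k != 0 by rewrite expf_neq0.
  rewrite !exprMn !exprVn !exprMn !exprVn !exprS !expr0.
  move: (x ^+ k) (y ^+ k) ((a + b) ^+ k) ((s + t) ^+ k) yk abk stk => X Y A B yk abk stk.
  by field; rewrite stk abk yk abn.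
by rewrite mulrDr !e// -mulrDr.
Qed.

Lemma subr1_expr_le (R : realType) (z : R) (m : nat) : 0 <= z <= 1 ->
  (1 - z) ^+ m * (1 + m%:R * z) <= 1.
Proof.
move=> /andP[z0 z1]; elim: m => [|m IH]; first by rewrite expr0 mul0r addr0 mulr1.
apply: le_trans IH; rewrite exprS [(1 - z) * _]mulrC -mulrA.
apply: ler_wpM2l; first by rewrite exprn_ge0// subr_ge0.
rewrite -natr1; have : 0 <= m%:R :> R by exact: ler0n.
move: (m%:R : R) => q q0; have : 0 <= q * z * z by rewrite !mulr_ge0.
nra.
Qed.

(* [n0] and [n1] stand for [|e^(i th) u + e^(- i th) v| ^ 2] and
   [|e^(- i th) u + e^(i th) v| ^ 2], with [a = |u|], [b = |v|], [z = sin th ^ 2] *)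
Lemma two_point (R : realType) (m : nat) (a b z n0 n1 s t : R) :
  0 <= a -> 0 <= b -> 0 < s -> 0 < t -> 0 <= z <= 1 -> 1 <= m.+1%:R * z ->
  0 <= n0 <= (a + b) ^+ 2 -> 0 <= n1 <= (a + b) ^+ 2 ->
  n0 + n1 <= 2 * ((a + b) ^+ 2 - 4 * a * b * z) ->
  n0 ^+ m.+1 + n1 ^+ m.+1 <=
    16 / 5 * ((s + t) ^+ (2 * m) *
      (a ^+ (2 * m.+1) / s ^+ (2 * m) + b ^+ (2 * m.+1) / t ^+ (2 * m))).
Proof.
move=> a0 b0 s0 t0 z01 mz; wlog le01 : n0 n1 / n0 <= n1 => [hw|].
  move=> h0 h1 h; have /orP[le|le] := le_total n0 n1; first exact: hw.
  by rewrite addrC; apply: hw => //; rewrite addrC.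
move=> /andP[n00 _] /andP[n10 n1le] nle.
have [ab0|abn] := eqVneq (a + b) 0.
  have n1e : n1 = 0 by apply/eqP; rewrite eq_le n10 (le_trans n1le)// ab0 expr0n.
  have n0e : n0 = 0 by apply/eqP; rewrite eq_le n00 (le_trans le01)// n1e.
  rewrite n0e n1e expr0n/= addr0 !(mulr_ge0, addr_ge0, exprn_ge0, invr_ge0, divr_ge0)//.
  - lra.
  - by rewrite ltW// addr_gt0.
  - exact: ltW.
  - exact: ltW.
have ab0 : 0 < a + b by rewrite lt_def abn addr_ge0.
have := @power_mean_ge R a b s t (2 * m) a0 b0 s0 t0.
have -> : (2 * m).+2 = (2 * m.+1)%N by rewrite mulnS add2n.
move=> /(ler_wpM2l (_ : 0 <= 16 / 5)) h; apply: le_trans (h _); last lra.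
have A0 : 0 < (a + b) ^+ 2 by rewrite exprn_gt0.
rewrite exprM; set A := (a + b) ^+ 2 in A0 n1le nle *.
set q := (a - b) ^+ 2 / A.
have q01 : 0 <= q <= 1.
  rewrite /q divr_ge0 ?sqr_ge0 ?(ltW A0)//= ler_pdivrMr// mul1r /A; nra.
have wE : 4 * a * b = A * (1 - q).
  by rewrite /q mulrBr mulrCA divff ?gt_eqF// /A; ring.
(* The smaller value is at most half of the bound on the sum, so it carries the whole loss. *)
have n0le : n0 <= A * (1 - (1 - q) * z) by rewrite wE in nle; lra.
have wz : 0 <= (1 - q) * z <= 1.
  by move: q01 z01 => /andP[? ?] /andP[? ?]; apply/andP; split; nra.
have P1 : n1 ^+ m.+1 <= A ^+ m.+1 by rewrite lerXn2r ?nnegrE// ltW.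
have P0 : n0 ^+ m.+1 <= A ^+ m.+1 * (1 - (1 - q) * z) ^+ m.+1.
  rewrite -exprMn lerXn2r ?nnegrE// mulr_ge0 ?(ltW A0)// subr_ge0.
  by case/andP: wz.
have P2 := @subr1_expr_le R ((1 - q) * z) m.+1 wz.
have P3 : (1 - (1 - q) * z) ^+ m.+1 * (1 + (1 - q)) <= 1.
  apply: le_trans P2; apply: ler_wpM2l.
    by rewrite exprn_ge0// subr_ge0; case/andP: wz.
  by rewrite lerD2l mulrCA ler_peMr// subr_ge0; case/andP: q01.
set p := (1 - (1 - q) * z) ^+ m.+1 in P0 P3 *.
set B := A ^+ m.+1 in P0 P1 *.
have B0 : 0 <= B by rewrite exprn_ge0// ltW.
(* [P3] gives p <= 1 / (2 - q) <= (1 + q) / 2. Then (3 + q) / 2 <= 8 / 5 + 2 q / 5, with equality at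
   q = 1: this is what dictates 16 / 5. *)
have key : 1 + p <= 16 / 5 * ((1 + q / 4) / 2).
  move: q01 => /andP[q0 q1]; have : p <= 1 / 2 + q / 2; last by lra.
  by nra.
have := ler_wpM2l B0 key; lra.
Qed.

(** * Moments of exponential sums *)

Definition cons_vec (n : nat) (b : bool) (x : signvec n) : signvec n.+1 :=
  [ffun i => if unlift ord0 i is Some j then x j else b].

Lemma cons_vec0 (n : nat) b (x : signvec n) : cons_vec b x ord0 = b.
Proof. by rewrite ffunE unlift_none. Qed.

Lemma cons_vecS (n : nat) b (x : signvec n) j : cons_vec b x (lift ord0 j) = x j.
Proof. by rewrite ffunE liftK. Qed.

Lemma sum_cons_vec (V : nmodType) (n : nat) (P : pred (signvec n.+1))
    (F : signvec n.+1 -> V) :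
  \sum_(x | P x) F x =
    \sum_(x | P (cons_vec false x)) F (cons_vec false x) +
    \sum_(x | P (cons_vec true x)) F (cons_vec true x).
Proof.
pose h (bx : bool * signvec n) := cons_vec bx.1 bx.2.
pose h' (x : signvec n.+1) : bool * signvec n := (x ord0, [ffun j => x (lift ord0 j)]).
have hK : cancel h h'.
  by case=> b x; rewrite /h' /h /= cons_vec0; congr pair; apply/ffunP => j;
    rewrite ffunE cons_vecS.
have h'K : cancel h' h.
  move=> x; apply/ffunP => i; rewrite /h /h' ffunE /=.
  by case: unliftP => [j ->|->]; rewrite ?ffunE.
rewrite (reindex h) /=; last by exists h' => ? _; [exact: hK|exact: h'K].
rewrite big_mkcond -(pair_bigA _ (fun b x => if P (h (b, x)) then F (h (b, x)) else 0))
  /=.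
by rewrite big_bool addrC -!big_mkcond.
Qed.

Lemma inner_cons_vec (n : nat) b c (x y : signvec n) :
  inner (cons_vec b x) (cons_vec c y) = (-1) ^+ b * (-1) ^+ c + inner x y.
Proof.
rewrite /inner big_ord_recl /sgn_coord !cons_vec0; congr (_ + _).
by apply: eq_bigr => j _; rewrite !cons_vecS.
Qed.

(** Real part of the sum of e^(i th <x, y>) over y in B; [sin_sum] is its imaginary part and
    [sqnorm_sum] its squared modulus. *)
Definition cos_sum (R : realType) (n : nat) (th : R) (B : {set signvec n})
    (x : signvec n) : R :=
  \sum_(y in B) cos ((inner x y)%:~R * th).

Definition sin_sum (R : realType) (n : nat) (th : R) (B : {set signvec n})
    (x : signvec n) : R :=
  \sum_(y in B) sin ((inner x y)%:~R * th).

Definition sqnorm_sum (R : realType) (n : nat) (th : R) (B : {set signvec n})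
    (x : signvec n) : R :=
  cos_sum th B x ^+ 2 + sin_sum th B x ^+ 2.

Definition slice (n : nat) (B : {set signvec n.+1}) (c : bool) : {set signvec n} :=
  [set y | cons_vec c y \in B]%SET.

Lemma sum_slice (V : nmodType) (n : nat) (B : {set signvec n.+1}) (F : signvec n.+1 -> V)
  :
  \sum_(y in B) F y =
    \sum_(y in slice B false) F (cons_vec false y) +
    \sum_(y in slice B true) F (cons_vec true y).
Proof. by rewrite sum_cons_vec; congr (_ + _); apply: eq_bigl => y; rewrite inE. Qed.

Lemma card_slice (n : nat) (B : {set signvec n.+1}) :
  #|B| = (#|slice B false| + #|slice B true|)%N.
Proof.
by rewrite -!sum1_card; exact: (@sum_slice nat).
Qed.

(** Real part of e^(i th) U + e^(- i th) V, where U and V are the exponential sums of the slices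
    whose first coordinate agrees, respectively disagrees, with b. *)
Lemma cos_sum_cons (R : realType) (n : nat) (th : R) (B : {set signvec n.+1})
    b (x : signvec n) (u := slice B b) (v := slice B (~~ b)) :
  cos_sum th B (cons_vec b x) =
    (cos th * cos_sum th u x - sin th * sin_sum th u x) +
    (cos th * cos_sum th v x + sin th * sin_sum th v x).
Proof.
have same c : \sum_(y in slice B c) cos ((inner (cons_vec c x) (cons_vec c y))%:~R * th)
    = cos th * cos_sum th (slice B c) x - sin th * sin_sum th (slice B c) x.
  rewrite !mulr_sumr -sumrB; apply: eq_bigr => y _.
  by rewrite inner_cons_vec -signr_addb addbb intrD mulrDl mul1r cosD.
have diff c : \sum_(y in slice B (~~ c)) cos ((inner (cons_vec c x) (cons_vec (~~ c)
  y))%:~R * th)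
    = cos th * cos_sum th (slice B (~~ c)) x + sin th * sin_sum th (slice B (~~ c)) x.
  rewrite !mulr_sumr -big_split; apply: eq_bigr => y _ /=.
  rewrite inner_cons_vec -signr_addb addbN addbb intrD mulrDl mulN1r cosD cosN sinN.
  by rewrite mulNr opprK.
rewrite [LHS](sum_slice _ (fun y => cos ((inner _ y)%:~R * th))) /u /v.
by case: b {u v} => /=; [rewrite addrC|]; rewrite same; congr (_ + _);
  [exact: (diff true)|exact: (diff false)].
Qed.

Lemma sin_sum_cons (R : realType) (n : nat) (th : R) (B : {set signvec n.+1})
    b (x : signvec n) (u := slice B b) (v := slice B (~~ b)) :
  sin_sum th B (cons_vec b x) =
    (cos th * sin_sum th u x + sin th * cos_sum th u x) +
    (cos th * sin_sum th v x - sin th * cos_sum th v x).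
Proof.
have same c : \sum_(y in slice B c) sin ((inner (cons_vec c x) (cons_vec c y))%:~R * th)
    = cos th * sin_sum th (slice B c) x + sin th * cos_sum th (slice B c) x.
  rewrite !mulr_sumr -big_split; apply: eq_bigr => y _ /=.
  by rewrite inner_cons_vec -signr_addb addbb intrD mulrDl mul1r sinD addrC.
have diff c : \sum_(y in slice B (~~ c)) sin ((inner (cons_vec c x) (cons_vec (~~ c)
  y))%:~R * th)
    = cos th * sin_sum th (slice B (~~ c)) x - sin th * cos_sum th (slice B (~~ c)) x.
  rewrite !mulr_sumr -sumrB; apply: eq_bigr => y _ /=.
  rewrite inner_cons_vec -signr_addb addbN addbb intrD mulrDl mulN1r sinD cosN sinN.
  by rewrite mulNr addrC.
rewrite [LHS](sum_slice _ (fun y => sin ((inner _ y)%:~R * th))) /u /v.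
by case: b {u v} => /=; [rewrite addrC|]; rewrite same; congr (_ + _);
  [exact: (diff true)|exact: (diff false)].
Qed.

Lemma sqnorm_sum_set0 (R : realType) (n : nat) (th : R) (x : signvec n) :
  sqnorm_sum th finset.set0 x = 0.
Proof. by rewrite /sqnorm_sum /cos_sum /sin_sum !big_set0 expr0n addr0. Qed.

Lemma sqnorm_sum_ge0 (R : realType) (n : nat) (th : R) B (x : signvec n) :
  0 <= sqnorm_sum th B x.
Proof. by rewrite addr_ge0 ?sqr_ge0. Qed.

(** The cross term is 2 Re (e^(2 i th) U conj V), with cos (2 th) and sin (2 th) written out. *)
Lemma sqnorm_sum_cons (R : realType) (n : nat) (th : R) (B : {set signvec n.+1})
    b (x : signvec n) (u := slice B b) (v := slice B (~~ b)) :
  sqnorm_sum th B (cons_vec b x) = sqnorm_sum th u x + sqnorm_sum th v x +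
    2 * ((cos th ^+ 2 - sin th ^+ 2) *
           (cos_sum th u x * cos_sum th v x + sin_sum th u x * sin_sum th v x)
         + 2 * cos th * sin th *
           (cos_sum th u x * sin_sum th v x - sin_sum th u x * cos_sum th v x)).
Proof.
rewrite /sqnorm_sum cos_sum_cons sin_sum_cons -/u -/v.
move: (cos_sum th u x) (sin_sum th u x) (cos_sum th v x) (sin_sum th v x) => p q p' q'.
transitivity ((cos th ^+ 2 + sin th ^+ 2) * (p ^+ 2 + q ^+ 2 + (p' ^+ 2 + q' ^+ 2)) +
  2 * ((cos th ^+ 2 - sin th ^+ 2) * (p * p' + q * q') +
       2 * cos th * sin th * (p * q' - q * p'))).
  by ring.
by rewrite cos2Dsin2 mul1r.
Qed.

Lemma dot_le_sqrt (R : realType) (p q p' q' : R) :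
  p * p' + q * q' <= Num.sqrt (p ^+ 2 + q ^+ 2) * Num.sqrt (p' ^+ 2 + q' ^+ 2).
Proof.
rewrite -sqrtrM ?addr_ge0 ?sqr_ge0//; apply: le_trans (ler_norm _) _.
rewrite -sqrtr_sqr ler_wsqrtr// -subr_ge0.
rewrite (_ : _ - _ = (p * q' - q * p') ^+ 2) ?sqr_ge0//; ring.
Qed.

Lemma sqnorm_sum_cons_le (R : realType) (n : nat) (th : R) (B : {set signvec n.+1})
    b (x : signvec n) :
  sqnorm_sum th B (cons_vec b x) <= (Num.sqrt (sqnorm_sum th (slice B false) x) +
                          Num.sqrt (sqnorm_sum th (slice B true) x)) ^+ 2.
Proof.
have -> : Num.sqrt (sqnorm_sum th (slice B false) x) + Num.sqrt (sqnorm_sum th (slice B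
  true) x)
  = Num.sqrt (sqnorm_sum th (slice B b) x) + Num.sqrt (sqnorm_sum th (slice B (~~ b)) x).
  by case: b => //; rewrite addrC.
rewrite sqnorm_sum_cons sqrrD !sqr_sqrtr ?sqnorm_sum_ge0// -addrA [leRHS]addrAC -addrA.
rewrite lerD2l lerD2l -[leRHS]mulr_natl ler_wpM2l//.
rewrite /sqnorm_sum.
move: (cos_sum _ _ x) (sin_sum _ _ x) (cos_sum _ _ x) (sin_sum _ _ x) => p q p' q'.
set c := cos th; set s := sin th.
(* Rotating (p, q) by an angle 2 th keeps its norm and turns the cross term into a plain dot
   product. *)
have -> : Num.sqrt (p ^+ 2 + q ^+ 2) = Num.sqrt
   (((c ^+ 2 - s ^+ 2) * p + 2 * c * s * q) ^+ 2 + ((c ^+ 2 - s ^+ 2) * q - 2 * c * s *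
     p) ^+ 2).
  congr Num.sqrt; rewrite [RHS](_ : _ = (c ^+ 2 + s ^+ 2) ^+ 2 * (p ^+ 2 + q ^+ 2));
    last by ring.
  by rewrite cos2Dsin2 expr1n mul1r.
apply: le_trans (dot_le_sqrt _ _ _ _); rewrite le_eqVlt; apply/orP; left; apply/eqP; ring.
Qed.

(** Exchanging the slices flips the sign of the sin (2 th) term, so it cancels in the sum. The
    hypothesis says cos (2 th) >= 0, which lets Cauchy-Schwarz bound the remaining term. *)
Lemma sqnorm_sum_consD_le (R : realType) (n : nat) (th : R) (B : {set signvec n.+1})
    (x : signvec n) (a := Num.sqrt (sqnorm_sum th (slice B false) x))
    (b := Num.sqrt (sqnorm_sum th (slice B true) x)) :
  sin th ^+ 2 <= 1 / 2 ->
  sqnorm_sum th B (cons_vec false x) + sqnorm_sum th B (cons_vec true x)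
    <= 2 * ((a + b) ^+ 2 - 4 * a * b * sin th ^+ 2).
Proof.
move=> hs; rewrite !sqnorm_sum_cons /=.
have aa : a ^+ 2 = sqnorm_sum th (slice B false) x by rewrite sqr_sqrtr ?sqnorm_sum_ge0.
have bb : b ^+ 2 = sqnorm_sum th (slice B true) x by rewrite sqr_sqrtr ?sqnorm_sum_ge0.
rewrite -aa -bb.
have := dot_le_sqrt (cos_sum th (slice B false) x) (sin_sum th (slice B false) x)
         (cos_sum th (slice B true) x) (sin_sum th (slice B true) x).
rewrite -!/(sqnorm_sum _ _ _) -/a -/b.
move: (cos_sum _ _ x) (sin_sum _ _ x) (cos_sum _ _ x) (sin_sum _ _ x) => p q p' q'.
rewrite cos2sin2; move: (sin th) hs => s hs h.
have h1 : 0 <= 1 - 2 * s ^+ 2 by lra.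
have := ler_wpM2l h1 h; move: (cos th) => c.
nra.
Qed.

(** Tensorization: [two_point] is applied for each x to the first coordinate, with the slice sizes
    as weights s and t. The induction hypothesis divided by s ^ (2 m) leaves (16 / 5) ^ n s, and the
    two slices recombine to s + t. *)
Lemma moment_bound (R : realType) (n m : nat) (th : R) (B : {set signvec n}) :
  sin th ^+ 2 <= 1 / 2 -> 1 <= m.+1%:R * sin th ^+ 2 ->
  \sum_x sqnorm_sum th B x ^+ m.+1 <= (16 / 5) ^+ n * #|B|%:R ^+ (2 * m).+1.
Proof.
move=> hs hm; elim: n B => [|n IH] B.
  have sv0 : #|signvec 0| = 1%N by rewrite card_ffun card_ord expn0.
  pose x0 : signvec 0 := [ffun=> false].
  have ev (x : signvec 0) : x = x0 by apply/ffunP => -[].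
  have [->|/finset.set0Pn[y yB]] := eqVneq B finset.set0.
    rewrite big1 ?mulr_ge0 ?exprn_ge0 ?divr_ge0// => x _.
    by rewrite sqnorm_sum_set0 expr0n.
  have -> : B = [set x0]%SET by apply/finset.setP => x;
    rewrite (ev x) -(ev y) yB inE eqxx.
  rewrite cards1 expr1n mulr1 expr0 (bigD1 x0)//= big1 => [|x /eqP];
    last by rewrite (ev x).
  rewrite /sqnorm_sum /cos_sum /sin_sum !big_set1.
  by rewrite cos2Dsin2 expr1n addr0.
rewrite sum_cons_vec /= -big_split /= card_slice.
have sq0 (b0 : bool) x : 0 <= sqnorm_sum th (slice B b0) x by exact: sqnorm_sum_ge0.
(* An empty slice would be a zero weight in [two_point]. In that case both signs of the first
   coordinate give the same modulus, and the resulting factor 2 is below 16 / 5. *)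
have deg b : slice B b = finset.set0 -> forall c x,
    sqnorm_sum th B (cons_vec c x) = sqnorm_sum th (slice B (~~ b)) x.
  move=> h c x; rewrite sqnorm_sum_cons.
  have [e|e] : c = b \/ c = ~~ b by case: (c) (b) => -[]; auto.
    rewrite e h sqnorm_sum_set0 /cos_sum /sin_sum !big_set0; ring.
  by rewrite e negbK h sqnorm_sum_set0 /cos_sum /sin_sum !big_set0; ring.
have edge b : slice B b = finset.set0 ->
   \sum_x (sqnorm_sum th B (cons_vec false x) ^+ m.+1 + sqnorm_sum th B (cons_vec true x)
     ^+ m.+1)
   <= (16 / 5) ^+ n.+1 * #|slice B (~~ b)|%:R ^+ (2 * m).+1.
  move=> h; under eq_bigr do rewrite !(deg b h) -mulr2n -mulr_natl.
  rewrite -mulr_sumr exprS -mulrA; apply: ler_pM => //.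
  - by rewrite sumr_ge0// => x _; rewrite exprn_ge0.
  - lra.
have [/edge|n0] := eqVneq (slice B false) finset.set0.
  by move=> h; apply: le_trans h _; rewrite ler_wpM2l ?exprn_ge0 ?divr_ge0// lerXn2r
    ?nnegrE// ler_nat leq_addl.
have [/edge|n1] := eqVneq (slice B true) finset.set0.
  by move=> h; apply: le_trans h _; rewrite ler_wpM2l ?exprn_ge0 ?divr_ge0// lerXn2r
    ?nnegrE// ler_nat leq_addr.
set s : R := #|slice B false|%:R; set t : R := #|slice B true|%:R.
have s0 : 0 < s by rewrite ltr0n card_gt0.
have t0 : 0 < t by rewrite ltr0n card_gt0.
have sqe b x : Num.sqrt (sqnorm_sum th (slice B b) x) ^+ (2 * m.+1) =
    sqnorm_sum th (slice B b) x ^+ m.+1 by rewrite exprM sqr_sqrtr.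
apply: (@le_trans _ _ (\sum_x 16 / 5 * ((s + t) ^+ (2 * m) *
      (sqnorm_sum th (slice B false) x ^+ m.+1 / s ^+ (2 * m) +
       sqnorm_sum th (slice B true) x ^+ m.+1 / t ^+ (2 * m))))).
  apply: ler_sum => x _; rewrite -!sqe; apply: (@two_point R m _ _ (sin th ^+ 2)) => //.
  - by rewrite sqr_ge0 /=; lra.
  - by rewrite sqnorm_sum_ge0 sqnorm_sum_cons_le.
  - by rewrite sqnorm_sum_ge0 sqnorm_sum_cons_le.
  - exact: sqnorm_sum_consD_le.
rewrite -!mulr_sumr big_split /= -!mulr_suml natrD -/s -/t exprS.
have key b (r : R) : r = #|slice B b|%:R -> 0 < r ->
   (\sum_x sqnorm_sum th (slice B b) x ^+ m.+1) / r ^+ (2 * m) <= (16 / 5) ^+ n * r.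
  by move=> -> r0; rewrite ler_pdivrMr ?exprn_gt0// -mulrA -exprS.
have := lerD (key false s erefl s0) (key true t erefl t0).
rewrite -mulrDr => /(ler_wpM2l (exprn_ge0 (2 * m) (ltW (addr_gt0 s0 t0)))) h.
rewrite -[leRHS]mulrA; apply: ler_wpM2l; first lra.
by apply: le_trans h _; rewrite exprS; lra.
Qed.

(** * Decay of bilinear sums and Fourier inversion *)

(** The left side is the tangent at M of the convex function z ^ (k + 1). *)
Lemma expr_tangent_le (R : realType) (z M : R) (k : nat) : 0 <= z -> 0 <= M ->
  M ^+ k * (k.+1%:R * z - k%:R * M) <= z ^+ k.+1.
Proof.
move=> z0 M0; elim: k => [|k IH]; first by rewrite expr0 expr1 mul0r subr0 !mul1r.
rewrite [leRHS]exprS; have := ler_wpM2l z0 IH; apply: le_trans.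
have Mk : 0 <= M ^+ k by rewrite exprn_ge0.
rewrite exprS -!natr1.
have : 0 <= k%:R :> R by exact: ler0n.
move: (k%:R : R) (M ^+ k) Mk => q X X0 q0.
have := mulr_ge0 X0 (mulr_ge0 (addr_ge0 q0 ler01) (sqr_ge0 (z - M))).
lra.
Qed.

(** Jensen's inequality for a power: the tangents at the mean M are summed. *)
Lemma sum_expr_le (R : realType) (I : finType) (A : {set I}) (F : I -> R) (k : nat) :
  (forall i, 0 <= F i) ->
  (\sum_(i in A) F i) ^+ k.+1 <= #|A|%:R ^+ k * \sum_(i in A) F i ^+ k.+1.
Proof.
move=> F0; have [->|An0] := eqVneq A finset.set0.
  by rewrite !big_set0 expr0n mulr0.
have A0 : 0 < #|A|%:R :> R by rewrite ltr0n card_gt0.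
set S := \sum_(i in A) F i; set M := S / #|A|%:R.
have S0 : 0 <= S by rewrite sumr_ge0.
have M0 : 0 <= M by rewrite divr_ge0// ltW.
have : \sum_(i in A) M ^+ k * (k.+1%:R * F i - k%:R * M) <= \sum_(i in A) F i ^+ k.+1.
  by apply: ler_sum => i _; exact: expr_tangent_le.
rewrite -mulr_sumr sumrB sumr_const -[_ *+ #|A|]mulr_natl -[X in X - _]mulr_sumr -/S.
have -> : k.+1%:R * S - #|A|%:R * (k%:R * M) = S.
  by rewrite -natr1 /M; field; rewrite gt_eqF.
move=> /(ler_wpM2l (exprn_ge0 k (ltW A0))); apply: le_trans.
by rewrite mulrA -exprMn (_ : _ * M = S) ?exprSr// mulrC divfK ?gt_eqF.
Qed.

(** Jensen over A, then the imaginary part is bounded by the modulus and the sum over A is extended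
    to all x, where [moment_bound] applies. *)
Lemma bilinear_moment (R : realType) (n m : nat) (th : R) (A B : {set signvec n}) :
  sin th ^+ 2 <= 1 / 2 -> 1 <= m.+1%:R * sin th ^+ 2 ->
  `|\sum_(x in A) sin_sum th B x| ^+ (2 * m.+1) <=
    (16 / 5) ^+ n * (#|A|%:R * #|B|%:R) ^+ (2 * m).+1.
Proof.
move=> hs hm.
have le1 : `|\sum_(x in A) sin_sum th B x| ^+ (2 * m.+1) <=
    (\sum_(x in A) `|sin_sum th B x|) ^+ (2 * m.+1).
  by rewrite lerXn2r ?nnegrE ?sumr_ge0// ler_norm_sum.
apply: le_trans le1 _; rewrite mulnS add2n.
apply: le_trans (@sum_expr_le R _ A _ _ (fun=> normr_ge0 _)) _.
rewrite [(#|A|%:R * _) ^+ _]exprMn mulrCA; apply: ler_wpM2l; first by rewrite exprn_ge0.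
apply: le_trans (moment_bound B hs hm).
apply: (@le_trans _ _ (\sum_(x in A) sqnorm_sum th B x ^+ m.+1)).
  apply: ler_sum => x _; rewrite -[(2 * m).+2]add2n -mulnS exprM real_normK ?num_real//.
  by rewrite lerXn2r ?nnegrE ?sqr_ge0 ?sqnorm_sum_ge0// lerDr sqr_ge0.
rewrite [leRHS](bigID (mem A)) /= lerDl sumr_ge0// => x _.
by rewrite exprn_ge0// sqnorm_sum_ge0.
Qed.

(** * Elementary trigonometric bounds and decay of the bilinear sum *)

Section Sine.

Import numFieldNormedType.Exports.

Lemma sin_MVT (R : realType) (x : R) : 0 < x ->
  exists2 c, 0 < c < x & sin x = cos c * x.
Proof.
move=> x0; have drv (y : R) : y \in `]0, x[ -> is_derive y 1 sin (cos y).
  by move=> _; exact: is_derive_sin.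
have cont : {within `[0, x], continuous (@sin R)}.
  by apply: continuous_subspaceT; exact: continuous_sin.
have [c] := MVT x0 drv cont.
by rewrite sin0 !subr0 in_itv /= => h e; exists c.
Qed.

End Sine.

Lemma normr_sin_le (R : realType) (x : R) : 0 <= x -> `|sin x| <= x.
Proof.
rewrite le_eqVlt => /predU1P[<-|x0]; first by rewrite sin0 normr0.
have [c _ ->] := sin_MVT x0; rewrite normrM (gtr0_norm x0) -[leRHS]mul1r.
by rewrite ler_pM2r// cos_max.
Qed.

Lemma cos2_ge_half (R : realType) (x : R) : 0 <= x <= pi / 4 -> 1 / 2 <= cos x ^+ 2.
Proof.
move=> /andP[x0 x1]; have : 0 <= cos (x *+ 2).
  have p0 := @pi_gt0 R.
  by apply: cos_ge0_pihalf; rewrite -mulr_natl; apply/andP; split; lra.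
rewrite cos_mulr2n -mulr_natl; lra.
Qed.

Lemma sin2_le_half (R : realType) (x : R) : 0 <= x <= pi / 4 -> sin x ^+ 2 <= 1 / 2.
Proof. by move=> /cos2_ge_half; rewrite sin2cos2; lra. Qed.

Lemma sin_ge_half (R : realType) (x : R) : 0 < x <= pi / 4 -> x / 2 <= sin x.
Proof.
move=> /andP[x0 x1]; have [c /andP[c0 c1] ->] := sin_MVT x0.
rewrite mulrC ler_pM2r//; have : 1 / 2 <= cos c ^+ 2 by apply: cos2_ge_half; apply/andP;
  split; lra.
have : 0 <= cos c.
  by apply: cos_ge0_pihalf; have p0 := @pi_gt0 R; apply/andP; split; lra.
have := cos_le1 c; move: (cos c) => z; nra.
Qed.

(* The constant 32 * 9 comes from 4 m th^2 <= 32, as m sin^2 th <= 2 and sin th >= th / 2,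
   and from ln (9 / 8) >= 1 / 9. *)
Lemma bilinear_decay (R : realType) (n : nat) (th : R) (A B : {set signvec n}) :
  0 < th <= pi / 4 -> (18 / 5) ^+ n <= #|A|%:R * #|B|%:R :> R ->
  `|\sum_(x in A) sin_sum th B x| <=
    #|A|%:R * #|B|%:R / (1 + n%:R / (32 * 9) * th ^+ 2) ^+ 2.
Proof.
move=> hth big; have /andP[th0 th1] := hth.
set P := #|A|%:R * #|B|%:R in big *.
have P0 : 0 < P by apply: lt_le_trans big; rewrite exprn_gt0// divr_gt0.
have s0 : 0 < sin th by apply: lt_le_trans (sin_ge_half hth); rewrite divr_gt0.
have s2 : sin th ^+ 2 <= 1 / 2 by apply: sin2_le_half; rewrite ltW.
have s20 : 0 < sin th ^+ 2 by rewrite exprn_gt0.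
(* The exponent is chosen so that 1 <= (m + 1) sin^2 th <= 2: large enough for the moment bound,
   small enough for the decay rate. *)
pose m := Num.truncn (sin th ^- 2).
have /andP[m1 m2] : m%:R <= sin th ^- 2 < m.+1%:R.
  by apply: truncn_itv; rewrite invr_ge0 ltW.
have hm : 1 <= m.+1%:R * sin th ^+ 2 by rewrite -ler_pdivrMr// mul1r ltW.
have hm2 : m.+1%:R * sin th ^+ 2 <= 2.
  rewrite -natr1 mulrDl mul1r; move: m1; rewrite -[_ ^- 2]mul1r ler_pdivlMr// => m1.
  by apply: le_trans (_ : 1 + 1 / 2 <= _); [exact: lerD|lra].
have := bilinear_moment A B s2 hm; rewrite -/P.
set F := `| _ |; set a := n%:R / (32 * 9).
have F0 : 0 <= F by exact: normr_ge0.
have a0 : 0 <= a by rewrite divr_ge0// mulr_ge0.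
set q := 1 + a * th ^+ 2.
have q0 : 0 < q by rewrite ltr_pwDl// mulr_ge0 ?sqr_ge0.
(* It is shown at the power 2 (m + 1): there (16 / 5) ^ n / P <= (8 / 9) ^ n pays for the factor (9
   / 8) ^ n that bounds the power of q. *)
move=> mom; suff : F / P * q ^+ 2 <= 1.
  by rewrite mulrAC ler_pdivrMr// mul1r -ler_pdivlMr ?exprn_gt0.
have qle : q ^+ 2 ^+ (2 * m.+1) <= (9 / 8) ^+ n.
  rewrite -exprM; apply: (@le_trans _ _ (expR (a * th ^+ 2) ^+ (2 * (2 * m.+1)))).
    by rewrite lerXn2r ?nnegrE ?(ltW q0) ?expR_ge0// expR_ge1Dx.
  rewrite -expRM_natl.
  apply: (@le_trans _ _ (expR (1 / 9) ^+ n)); last first.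
    rewrite lerXn2r ?nnegrE ?expR_ge0 ?divr_ge0//.
    have h := expR_ge1Dx (- (1 / 9) : R); rewrite expRN in h.
    have e0 := expR_gt0 (1 / 9 : R).
    rewrite -[leLHS]invrK -[9 / 8]invrK lef_pV2 ?posrE ?invr_gt0//; last lra.
  rewrite -expRM_natl ler_expR.
  have th4 : th ^+ 2 <= 4 * sin th ^+ 2.
    have := sin_ge_half hth; nra.
  have -> : n%:R * (1 / 9) = 32 * a :> R by rewrite /a; field.
  rewrite mulrCA mulrC ler_wpM2r// !natrM.
  have := ler_wpM2l (ler0n R m.+1) th4; move: hm2; lra.
have : (F / P * q ^+ 2) ^+ (2 * m.+1) <= 1.
  rewrite exprMn expr_div_n.
  apply: (@le_trans _ _ ((8 / 9) ^+ n * (9 / 8) ^+ n)); last first.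
    by rewrite -exprMn (_ : 8 / 9 * (9 / 8) = 1) ?expr1n//; field.
  apply: ler_pM => //.
  - by rewrite divr_ge0// exprn_ge0// ltW.
  - by rewrite !exprn_ge0// ltW.
  rewrite ler_pdivrMr ?exprn_gt0//; apply: le_trans mom _.
  rewrite (_ : 2 * m.+1 = (2 * m).+2)%N ?mulnS// [P ^+ (2 * m).+2]exprS mulrA ler_wpM2r
    ?exprn_ge0 ?(ltW P0)//.
  apply: (@le_trans _ _ ((8 / 9) ^+ n * (18 / 5) ^+ n)).
    by rewrite -exprMn (_ : 16 / 5 = 8 / 9 * (18 / 5)) //; field.
  by rewrite ler_wpM2l// exprn_ge0// divr_ge0.
rewrite expr_le1 ?muln_gt0//.
by rewrite mulr_ge0 ?divr_ge0 ?exprn_ge0 ?(ltW P0) ?(ltW q0).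
Qed.

(** A Riemann sum of x / (1 + a x^2)^2, compared with the increments of a^-1 (1 - 1 / (1 + a x^2)).
    That function is an antiderivative of twice the summand; the factor 2 leaves room for the
    sampling at right endpoints. *)
Lemma telescoping_kernel_sum (R : realType) (a h : R) (n : nat) : 0 < a -> 0 <= h ->
  \sum_(j < n) h * (j.+1%:R * h) / (1 + a * (j.+1%:R * h) ^+ 2) ^+ 2 <= a^-1.
Proof.
move=> a0 h0.
have pos (x : R) : 0 < 1 + a * x ^+ 2 by rewrite ltr_pwDl// mulr_ge0 ?sqr_ge0// ltW.
suff : \sum_(j < n) h * (j.+1%:R * h) / (1 + a * (j.+1%:R * h) ^+ 2) ^+ 2 <=
    a^-1 * (1 - (1 + a * (n%:R * h) ^+ 2)^-1).
  move=> /le_trans; apply; rewrite ler_piMr ?invr_ge0 ?(ltW a0)//.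
  by rewrite gerBl invr_ge0 ltW.
elim: n => [|n IH]; first by rewrite big_ord0 mul0r expr0n mulr0 addr0 invr1 subrr mulr0.
rewrite big_ord_recr /=; apply: le_trans (lerD IH (lexx _)) _.
have x0 : 0 <= n%:R * h by rewrite mulr_ge0.
rewrite -natr1 mulrDl mul1r; move: (n%:R * h) x0 => x x0.
have := pos x; have := pos (x + h); set u := 1 + a * (x + h) ^+ 2;
  set v := 1 + a * x ^+ 2.
move=> u0 v0; rewrite -lerBrDl.
have -> : a^-1 * (1 - u^-1) - a^-1 * (1 - v^-1) = (u - v) / (a * (u * v)).
  by field; rewrite !gt_eqF.
rewrite ler_pdivrMr ?exprn_gt0// mulrAC ler_pdivlMr ?mulr_gt0//.
have -> : u - v = a * (h * (2 * x + h)) by rewrite /u /v; ring.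
have vu : v <= u.
  by rewrite lerD2l ler_pM2l// lerXn2r ?nnegrE ?addr_ge0// lerDl.
have : a * (h * (x + h)) * (u * v) <= a * (h * (x + h)) * u ^+ 2.
  by rewrite expr2 ler_wpM2l ?mulr_ge0 ?(ltW a0) ?addr_ge0// ler_wpM2l// ltW.
have := mulr_ge0 (mulr_ge0 (ltW a0) (mulr_ge0 h0 x0)) (sqr_ge0 u).
nra.
Qed.

(** * Discrete Fourier inversion *)

Lemma sin_natpi (R : realType) (l : nat) : sin (l%:R * pi) = 0 :> R.
Proof.
elim: l => [|l IH]; first by rewrite mul0r sin0.
by rewrite -natr1 mulrDl mul1r sinDpi IH oppr0.
Qed.

Lemma cos_absz (R : realType) (l : int) (x : R) : cos (l%:~R * x) = cos (`|l|%N%:R * x).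
Proof.
by case: l => l //; rewrite NegzE mulrNz mulNr cosN abszN absz_nat.
Qed.

(** Multiplied by sin (l pi / M), the sum telescopes to sin (l pi) = 0. As M is odd, the nonzero
    frequencies pair up as j and - j, whence the cosines. *)
Lemma dirichlet_kernel (R : realType) (n l : nat) (M := (2 * n).+1) : (l < M)%N ->
  1 + 2 * \sum_(j < n) cos (l%:R * (2 * pi * j.+1%:R / M%:R)) =
    if l == 0%N then M%:R else 0 :> R.
Proof.
move=> lM; have M0 : M%:R != 0 :> R by rewrite pnatr_eq0.
have ME : M%:R = 2 * n%:R + 1 :> R by rewrite /M -addn1 natrD natrM.
case: eqP => [->|/eqP l0].
  under eq_bigr do rewrite mul0r cos0.
  by rewrite sumr_const card_ord ME; lra.
set p : R := l%:R * pi / M%:R.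
have p0 : 0 < p by rewrite /p !(mulr_gt0, divr_gt0, pi_gt0, ltr0n, lt0n, invr_gt0).
have p1 : p < pi.
  by rewrite /p ltr_pdivrMr ?ltr0n// mulrC ltr_pM2l ?pi_gt0// ltr_nat.
have s0 : sin p != 0 by rewrite gt_eqF// sin_gt0_pi// p0 p1.
apply: (mulfI s0); rewrite mulr0.
have -> : \sum_(j < n) cos (l%:R * (2 * pi * j.+1%:R / M%:R)) = \sum_(j < n) cos (2 *
  j.+1%:R * p).
  by apply: eq_bigr => j _; congr cos; rewrite /p; ring.
transitivity (sin ((2 * n%:R + 1) * p)); last first.
  have -> : (2 * n%:R + 1) * p = l%:R * pi; last exact: sin_natpi.
  by move: M0; rewrite /p ME => M0; field.
elim: (n) => [|k IH]; first by rewrite big_ord0 !mulr0 addr0 add0r mulr1 mul1r.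
rewrite big_ord_recr /= [2 * (_ + _)]mulrDr addrA mulrDr IH -[k.+1%:R]natr1.
have -> : (2 * k%:R + 1) * p = 2 * (k%:R + 1) * p - p by ring.
have -> : (2 * (k%:R + 1) + 1) * p = 2 * (k%:R + 1) * p + p by ring.
by rewrite sinB sinD; ring.
Qed.

(** Product-to-sum formulas give Dirichlet kernels at l - s and l + s, and the hypothesis excludes
    aliasing modulo M. Because the frequencies are multiples of 4, the sample points can all be
    taken below pi / 4, where [bilinear_decay] holds. *)
Lemma sin_orthogonality (R : realType) (n s : nat) (l : int) (M := (2 * n).+1) :
  (`|l| + s < M)%N ->
  4 / M%:R * \sum_(j < n) sin (4 * s%:R * (j.+1%:R * (pi / (2 * M%:R)))) *
                          sin ((4 * l)%:~R * (j.+1%:R * (pi / (2 * M%:R)))) =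
  (l == s%:Z)%:R - (l == - s%:Z)%:R :> R.
Proof.
move=> lsM; have M0 : M%:R != 0 :> R by rewrite pnatr_eq0.
have dk (z : int) : (`|z| < M)%N ->
    1 + 2 * \sum_(j < n) cos (z%:~R * (2 * pi * j.+1%:R / M%:R)) = (z == 0)%:R * M%:R :>
      R.
  move=> /(@dirichlet_kernel R n); under eq_bigr do rewrite -cos_absz.
  by rewrite absz_eq0 => ->; case: (z == 0); rewrite ?mul1r ?mul0r.
have h1 := dk (l - s%:Z) ltac:(lia); have h2 := dk (l + s%:Z) ltac:(lia).
rewrite subr_eq0 in h1; rewrite addr_eq0 in h2.
apply: (mulIf M0); rewrite mulrBl -h1 -h2.
rewrite opprD addrACA subrr add0r -mulrBr -sumrB mulrAC divfK//.
rewrite !mulr_sumr; apply: eq_bigr => j _.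
set y : R := 4 * (j.+1%:R * (pi / (2 * M%:R))).
have -> : 2 * pi * j.+1%:R / M%:R = y by rewrite /y; field.
have -> : 4 * s%:R * (j.+1%:R * (pi / (2 * M%:R))) = s%:R * y by rewrite /y; ring.
have -> : (4 * l)%:~R * (j.+1%:R * (pi / (2 * M%:R))) = l%:~R * y.
  by rewrite intrM /y; ring.
have -> : (l - s%:Z)%:~R * y = l%:~R * y - s%:R * y by rewrite intrB mulrBl.
have -> : (l + s%:Z)%:~R * y = l%:~R * y + s%:R * y by rewrite intrD mulrDl.
rewrite cosB cosD; ring.
Qed.

(** * Discrepancy of rectangles and protocols *)

Definition weight (n : nat) (x : signvec n) : nat := (\sum_(j < n) x j)%N.

(** In terms of signs this is the coordinatewise product; its weight is the Hamming distance. *)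
Definition xorv (n : nat) (x y : signvec n) : signvec n := [ffun j => x j (+) y j].

Lemma xorvK (n : nat) (x y : signvec n) : xorv x (xorv x y) = y.
Proof. by apply/ffunP => j; rewrite !ffunE addKb. Qed.

Lemma xorv_bij (n : nat) (x : signvec n) : bijective (xorv x).
Proof. by exists (xorv x); exact: xorvK. Qed.

Lemma weight_le (n : nat) (x : signvec n) : (weight x <= n)%N.
Proof.
rewrite -[leqRHS]card_ord -sum1_card; apply: leq_sum => j _; exact: leq_b1.
Qed.

Lemma weight_card (n : nat) (x : signvec n) : weight x = #|[set j | x j]%SET|.
Proof.
by rewrite -sum1_card /weight [RHS]big_mkcond; apply: eq_bigr => j _; rewrite inE;
  case: (x j).
Qed.

Lemma inner_weight (n : nat) (x y : signvec n) :
  inner x y = n%:Z - (2 * weight (xorv x y))%:Z.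
Proof.
have -> : n%:Z = \sum_(j < n) 1 by rewrite sumr_const card_ord natz.
rewrite /weight PoszM -[X in _ * X]natz natr_sum mulr_sumr -sumrB /inner.
by apply: eq_bigr => j _; rewrite /sgn_coord ffunE -signr_addb natz; case: addb.
Qed.

Lemma inner_bound (n : nat) (x y : signvec n) : (`|inner x y| <= n)%N.
Proof. by have := weight_le (xorv x y); rewrite inner_weight; lia. Qed.

(* Between even vectors the inner product is determined modulo 4; this removes the
   alias at frequency pi / 2 of the Fourier transform of the inner product. *)
Definition even_vec (n : nat) : {set signvec n} := [set x | ~~ odd (weight x)]%SET.

Lemma odd_weight_xorv (n : nat) (x y : signvec n) :
  odd (weight (xorv x y)) = odd (weight x) (+) odd (weight y).
Proof.
rewrite /weight; elim/big_rec3 : _ => // j a b c _; rewrite !oddD ffunE !oddb => ->.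
by case: (x j) (y j) (odd a) (odd b) => -[] [] [].
Qed.

Lemma inner_even_vec (n : nat) (x y : signvec (4 * n)) :
  x \in even_vec (4 * n) -> y \in even_vec (4 * n) -> exists l : int, inner x y = 4 * l.
Proof.
rewrite !inE => ex ey; have : ~~ odd (weight (xorv x y))
  by rewrite odd_weight_xorv (negPf ex).
rewrite inner_weight; move: (weight _) => w ew.
by exists (n%:Z - w./2%:Z); have := odd_double_half w; rewrite (negPf ew); lia.
Qed.

Definition gap_sign (R : realType) (n k : nat) (x y : signvec n) : R :=
  (inner x y == k%:Z)%:R - (inner x y == - k%:Z)%:R.

(** A small rectangle is absorbed by (18 / 5) ^ n. For a large one, Fourier inversion is combined
    with |sin (4 s th)| <= 4 s th and the decay in th; the remaining sum over frequencies is of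
    order 1 / n. *)
Lemma discrepancy (R : realType) (n s : nat) (A B : {set signvec n}) :
  (0 < n)%N -> (s <= n)%N ->
  {in A & B, forall x y, exists l : int, inner x y = 4 * l} ->
  `|\sum_(x in A) \sum_(y in B) gap_sign R (4 * s) x y| <=
    16 * (32 * (9 * (s%:R / n%:R))) * (#|A|%:R * #|B|%:R) + (18 / 5) ^+ n.
Proof.
move=> n0 sn mod4; set P : R := #|A|%:R * #|B|%:R.
have P0 : 0 <= P by rewrite mulr_ge0.
have nR : 0 < n%:R :> R by rewrite ltr0n.
have c0 : 0 <= 16 * (32 * (9 * (s%:R / n%:R))) * P.
  by do 4 rewrite mulr_ge0//; rewrite divr_ge0.
have [big|small] := leP ((18 / 5) ^+ n) P; last first.
  apply: (@le_trans _ _ P); last first.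
    by apply: le_trans (ltW small) _; rewrite lerDr.
  apply: le_trans (ler_norm_sum _ _ _) _.
  rewrite /P -natrM -sum_nat_const natr_sum; apply: ler_sum => x _.
  apply: le_trans (ler_norm_sum _ _ _) _.
  rewrite -sum1_card natr_sum; apply: ler_sum => y _.
  rewrite /gap_sign; do 2 case: eqP => _;
    rewrite ?subrr ?subr0 ?sub0r ?normrN ?normr1 ?normr0//.
apply: ler_wpDr; first by rewrite exprn_ge0// divr_ge0.
set M := (2 * n).+1; have M0 : 0 < M%:R :> R by rewrite ltr0n.
have p2 := @pi_ge2 R; have p0 := @pi_gt0 R.
set h : R := pi / (2 * M%:R).
have h0 : 0 < h by rewrite divr_gt0// mulr_gt0.
have -> : \sum_(x in A) \sum_(y in B) gap_sign R (4 * s) x y =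
    4 / M%:R * \sum_(j < n) sin (4 * s%:R * (j.+1%:R * h)) *
                          \sum_(x in A) sin_sum (j.+1%:R * h) B x.
  rewrite mulr_sumr; under [RHS]eq_bigr do rewrite !mulr_sumr.
  rewrite [RHS]exchange_big /=; apply: eq_bigr => x xA.
  under [RHS]eq_bigr do rewrite /sin_sum !mulr_sumr.
  rewrite [RHS]exchange_big /=; apply: eq_bigr => y yB.
  rewrite -mulr_sumr /gap_sign; have [l e] := mod4 x y xA yB.
  rewrite e (@sin_orthogonality R n s l).
    by congr (_%:R - _%:R); apply/eqP/eqP; clear; lia.
  by move: sn (inner_bound x y); rewrite e; clear; lia.
set a : R := n%:R / (32 * 9).
have a0 : 0 < a by rewrite divr_gt0// mulr_gt0.
rewrite normrM ger0_norm ?divr_ge0//.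
apply: (@le_trans _ _ (4 / M%:R * \sum_(j < n)
    4 * s%:R * (j.+1%:R * h) * (P / (1 + a * (j.+1%:R * h) ^+ 2) ^+ 2))).
  apply: ler_wpM2l; first by rewrite divr_ge0.
  apply: le_trans (ler_norm_sum _ _ _) _; apply: ler_sum => j _.
  have t0 : 0 < j.+1%:R * h by rewrite mulr_gt0// ltr0n.
  rewrite normrM; apply: ler_pM => //.
    by apply: normr_sin_le; rewrite !mulr_ge0// ltW.
  apply: bilinear_decay => //; rewrite t0 /= /h mulrA ler_pdivrMr ?mulr_gt0//.
  rewrite mulrC -mulrA ler_pM2l// ler_pdivlMl// -!natrM ler_nat /M.
  by move: (ltn_ord j); clear; lia.
have := @telescoping_kernel_sum R a h n a0 (ltW h0).
move=> /(ler_wpM2l (_ : 0 <= 8 / pi * (4 * s%:R * P))) tel.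
have {}tel := tel ltac:(by rewrite !mulr_ge0// invr_ge0 ltW).
(* As pi >= 2, 8 / pi is at most 4; with the 4 of 4 s this gives 16, and 32 * 9 / n is 1 / a. *)
apply: le_trans (_ : _ <= 8 / pi * (4 * s%:R * P) * a^-1) _; last first.
  have -> : a^-1 = 32 * 9 / n%:R by rewrite /a invf_div.
  have -> : 16 * (32 * (9 * (s%:R / n%:R))) * P = 4 * (4 * s%:R * P) * (32 * 9 / n%:R).
    by field; rewrite gt_eqF.
  apply: ler_wpM2r; first by rewrite divr_ge0// mulr_ge0.
  apply: ler_wpM2r; first by do 2 rewrite mulr_ge0//.
  by rewrite ler_pdivrMr//; move: p2; clear; lra.
apply: le_trans tel; rewrite le_eqVlt; apply/orP; left; apply/eqP.
rewrite !mulr_sumr; apply: eq_bigr => j _.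
have -> : 4 / M%:R = 8 / pi * h.
  rewrite /h; move: (M%:R : R) pi M0 p0 => x y x0 y0.
  by field; rewrite !gt_eqF.
have alg (c q u v g Q : R) : c != 0 -> q != 0 ->
    8 / c * g * (4 * v * u * (Q / q ^+ 2)) = 8 / c * (4 * v * Q) * (g * u / q ^+ 2).
  by move=> c0' q0'; field; rewrite c0' q0'.
by apply: alg; rewrite gt_eqF// ltr_pwDl// mulr_ge0 ?sqr_ge0// ltW.
Qed.

(** Each bit splits one side of the rectangle. The density term is additive under such splits,
    whereas [eta] is paid once per leaf, hence at most 2 ^ d times. The maps [ax] and [ay] leave
    room for inputs that are embedded before the protocol is run. *)
Lemma protocol_discrepancy (R : realType) (S : finType) (X Y Z : Type)
    (ax : S -> X) (ay : S -> Y) (f : S -> S -> R) (E : {set S}) (delta eta : R) :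
  0 <= eta ->
  (forall A B : {set S}, A \subset E -> B \subset E ->
    `|\sum_(x in A) \sum_(y in B) f x y| <= delta * (#|A|%:R * #|B|%:R) + eta) ->
  0 <= delta ->
  forall (q : Z -> bool) (p : protocol X Y Z) (d : nat) (A B : {set S}),
  A \subset E -> B \subset E ->
  {in A & B, forall x y, (bits p (ax x) (ay y) <= d)%N} ->
  `|\sum_(x in A) \sum_(y in B | q (output p (ax x) (ay y))) f x y| <=
    delta * (#|A|%:R * #|B|%:R) + 2 ^+ d * eta.
Proof.
move=> eta0 H delta0 q.
have triv (A B : {set S}) (d : nat) : 0 <= delta * (#|A|%:R * #|B|%:R) + 2 ^+ d * eta.
  by rewrite addr_ge0 ?mulr_ge0 ?exprn_ge0.
have split (B C A0 A1 : {set S}) (F F0 F1 : R) (d : nat) : F = F0 + F1 ->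
    (#|C| = #|A0| + #|A1|)%N ->
    `|F0| <= delta * (#|A0|%:R * #|B|%:R) + 2 ^+ d * eta ->
    `|F1| <= delta * (#|A1|%:R * #|B|%:R) + 2 ^+ d * eta ->
    `|F| <= delta * (#|C|%:R * #|B|%:R) + 2 ^+ d.+1 * eta.
  move=> -> -> h0 h1; apply: le_trans (ler_normD _ _) _.
  by apply: le_trans (lerD h0 h1) _; rewrite natrD exprS; lra.
(* A node that sends a bit leaves no pair in a rectangle with bit bound 0. *)
have empty p (A B : {set S}) :
    {in A & B, forall x y, (bits p (ax x) (ay y) <= 0)%N} ->
    (forall x y, (0 < bits p x y)%N :> bool) ->
    \sum_(x in A) \sum_(y in B | q (output p (ax x) (ay y))) f x y = 0.
  move=> h pos; rewrite big1// => x xA; rewrite big1// => y /andP[yB _].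
  by have := h x y xA yB; rewrite leqNgt pos.
elim=> [z|g p1 IH1 p0 IH0|g p1 IH1 p0 IH0] d A B AE BE hd.
- have [qz|qz] := boolP (q z); last first.
    by rewrite big1 ?normr0// => x _; rewrite big1// => y /andP[].
  under eq_bigr do under eq_bigl do rewrite andbT.
  apply: le_trans (H A B AE BE) _; rewrite lerD2l ler_peMl//.
  by rewrite -natrX ler1n expn_gt0.
- case: d hd => [|d] hd; first by rewrite (empty _ _ _ hd)// normr0.
  pose A1 := [set x | g (ax x)]%SET.
  apply: (split B A (A :&: A1)%SET (A :\: A1)%SET _ _ _ d (big_setID A1 _)).
  + by rewrite cardsID.
  + rewrite (eq_bigr (fun x => \sum_(y in B | q (output p1 (ax x) (ay y))) f x y));
    last first.
      by move=> x; rewrite !inE /= => /andP[_ ->].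
    apply: IH1 => // [|x y]; first by rewrite (fintype.subset_trans (finset.subsetIl _
      _)).
    by rewrite !inE => /andP[xA gx] yB; have := hd x y xA yB; rewrite /= gx.
  + rewrite (eq_bigr (fun x => \sum_(y in B | q (output p0 (ax x) (ay y))) f x y));
    last first.
      by move=> x; rewrite !inE /= => /andP[/negPf ->].
    apply: IH0 => // [|x y]; first by rewrite (fintype.subset_trans (finset.subsetDl _
      _)).
    by rewrite !inE => /andP[/negPf gx xA] yB; have := hd x y xA yB; rewrite /= gx.
- case: d hd => [|d] hd; first by rewrite (empty _ _ _ hd)// normr0.
  pose B1 := [set y | g (ay y)]%SET.
  have e : \sum_(x in A) \sum_(y in B | q (output (Bob g p1 p0) (ax x) (ay y))) f x y =
    \sum_(x in A) \sum_(y in B :&: B1 | q (output p1 (ax x) (ay y))) f x y +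
    \sum_(x in A) \sum_(y in B :\: B1 | q (output p0 (ax x) (ay y))) f x y.
    rewrite -big_split; apply: eq_bigr => x _ /=; rewrite (bigID (fun y => g (ay y))) /=.
    congr (_ + _); apply: eq_bigl => y; rewrite !inE.
      by case: (y \in B) => //=; case: (g (ay y)) => /=; rewrite ?andbT ?andbF.
    by case: (y \in B) => /=; case: (g (ay y)) => /=; rewrite ?andbT ?andbF.
  rewrite [#|A|%:R * _]mulrC.
  apply: (split A B (B :&: B1)%SET (B :\: B1)%SET _ _ _ d e).
  + by rewrite cardsID.
  + rewrite [#|_|%:R * _]mulrC.
    apply: IH1 => // [|x y]; first by rewrite (fintype.subset_trans (finset.subsetIl _
      _)).
    by move=> xA; rewrite !inE => /andP[yB gy]; have := hd x y xA yB; rewrite /= gy.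
  + rewrite [#|_|%:R * _]mulrC.
    apply: IH0 => // [|x y]; first by rewrite (fintype.subset_trans (finset.subsetDl _
      _)).
    by move=> xA; rewrite !inE => /andP[/negPf gy yB]; have := hd x y xA yB;
      rewrite /= gy.
Qed.

(** * Counting and symmetrization *)

(** The bound 'C(2m, m) >= 4^m / (2 sqrt m), squared. The induction uses the ratio 2 (2m + 1) / (m +
    1) of consecutive central coefficients and 4 m (m + 1) <= (2m + 1)^2. *)
Lemma central_bin_ge (m : nat) : (0 < m)%N ->
  ((2 ^ (2 * m)) ^ 2 <= 4 * m * 'C(2 * m, m) ^ 2)%N.
Proof.
case: m => // m _; elim: m => [//|m IH].
set M := m.+1 in IH *.
have e : (M.+1 * 'C(2 * M.+1, M.+1) = 2 * (2 * M).+1 * 'C(2 * M, M))%N.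
  have -> : (2 * M.+1 = (2 * M).+2)%N by lia.
  rewrite binS.
  have <- : 'C((2 * M).+1, M.+1) = 'C((2 * M).+1, M).
    by rewrite -(@bin_sub (2 * M).+1 M.+1); [congr 'C(_, _)|]; lia.
  have := mul_bin_diag (2 * M).+1 M; rewrite /=; lia.
have -> : ((2 ^ (2 * M.+1)) ^ 2 = 16 * (2 ^ (2 * M)) ^ 2)%N.
  by rewrite mulnS expnD expnMn.
move: ((2 ^ (2 * M)) ^ 2)%N IH => Y IH.
rewrite -(@leq_pmul2l M.+1)//.
have -> : (M.+1 * (4 * M.+1 * 'C(2 * M.+1, M.+1) ^ 2) = 4 * (M.+1 * 'C(2 * M.+1, M.+1)) ^
  2)%N.
  by rewrite expnMn; lia.
rewrite e !expnMn; move: ('C(2 * M, M) ^ 2)%N IH => C2 IH.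
have h : (16 * M.+1 * Y <= 16 * M.+1 * (4 * M * C2))%N by rewrite leq_mul2l IH orbT.
have h2 : (16 * M.+1 * (4 * M) * C2 <= 4 * (2 ^ 2 * (2 * M).+1 ^ 2) * C2)%N.
  by rewrite leq_mul2r; apply/orP; right; lia.
lia.
Qed.

(** The loss is a fraction at most j^2 / m: the step from j to j + 1 costs at most (2j + 1) / m of
    the central coefficient, and the odd numbers sum to a square. *)
Lemma off_center_bin_ge (m j : nat) : (j <= m)%N ->
  (m * 'C(2 * m, m) <= m * 'C(2 * m, m - j) + j ^ 2 * 'C(2 * m, m))%N.
Proof.
have step i : (i < m)%N ->
    ((m - i) * 'C(2 * m, m - i) = (m + i.+1) * 'C(2 * m, m - i.+1))%N.
  move=> im; have := mul_bin_left (2 * m) (m - i.+1).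
  have -> : ((m - i.+1).+1 = m - i)%N by lia.
  by have -> : (2 * m - (m - i.+1) = m + i.+1)%N by lia.
suff : (j <= m)%N -> ('C(2 * m, m - j) <= 'C(2 * m, m))%N /\
   (m * 'C(2 * m, m) <= m * 'C(2 * m, m - j) + j ^ 2 * 'C(2 * m, m))%N.
  by move=> h /h[].
elim: j => [|j IH] jm; first by rewrite subn0; split=> //; lia.
have [h1 h2] := IH (ltnW jm); have := step _ jm.
move: ('C(2 * m, m)) ('C(2 * m, m - j)) ('C(2 * m, m - j.+1)) h1 h2 => c0 c1 c2 h1 h2 e.
have le21 : (c2 <= c1)%N.
  rewrite -(@leq_pmul2l (m + j.+1))//; last lia.
  by rewrite -e leq_mul2r; apply/orP; right; lia.
split; first lia.
have h3 : (m * c1 <= m * c2 + (2 * j + 1) * c1)%N by nia.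
nia.
Qed.

Lemma near_center_bin_ge (r s : nat) : (0 < r)%N -> (0 < s)%N ->
  (2 ^ (16 * (r * s) ^ 2) <=
     16 * (r * s) * 'C(16 * (r * s) ^ 2, 8 * (r * s) ^ 2 - 2 * s))%N.
Proof.
move=> r0 s0; set v := (r * s)%N; have v0 : (0 < v)%N by rewrite muln_gt0 r0.
have -> : (16 * v ^ 2 = 2 * (8 * v ^ 2))%N by lia.
set m := (8 * v ^ 2)%N.
have m0 : (0 < m)%N by rewrite muln_gt0 expn_gt0 v0.
have h1 := central_bin_ge m0.
have jm : (2 * s <= m)%N by rewrite /m /v; nia.
have h2 := off_center_bin_ge jm.
move: ('C(2 * m, m)) ('C(2 * m, m - 2 * s)) h1 h2 => c0 c1 h1 h2.
(* Here j = 2 s and m = 8 r^2 s^2, so the lost fraction j^2 / m is at most 1 / 2. *)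
have h3 : (c0 <= 2 * c1)%N.
  have : (8 * s ^ 2 * (r ^ 2 * c0) <= 8 * s ^ 2 * (r ^ 2 * c1) + 4 * s ^ 2 * c0)%N.
    by move: h2; rewrite /m /v expnMn; lia.
  have r1 : (1 <= r ^ 2)%N by rewrite expn_gt0 r0.
  have s1 : (0 < 4 * s ^ 2)%N by rewrite muln_gt0 expn_gt0 s0.
  move=> h; have {}h : (2 * (r ^ 2 * c0) <= 2 * (r ^ 2 * c1) + c0)%N.
    by rewrite -(leq_pmul2l s1); lia.
  move: (r ^ 2)%N r1 h => q q1 h; nia.
rewrite -(@leq_exp2r _ _ 2)//; apply: leq_trans h1 _.
have : (c0 ^ 2 <= (2 * c1) ^ 2)%N by rewrite leq_exp2r.
rewrite /m (expnMn 2 c1) (expnMn (16 * v) c1) (expnMn 16 v);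
  move: (c0 ^ 2)%N (c1 ^ 2)%N (v ^ 2)%N => x y z h.
have : (z * x <= z * (2 ^ 2 * y))%N by rewrite leq_mul2l h orbT.
lia.
Qed.

Lemma card_weight (n w : nat) : #|[set d : signvec n | weight d == w]%SET| = 'C(n, w).
Proof.
rewrite -[in RHS](card_ord n) -card_draws.
pose supp (d : signvec n) : {set 'I_n} := [set j | d j]%SET.
have supp_inj : injective supp.
  by move=> d d' /setP e; apply/ffunP => j; have := e j; rewrite !inE.
rewrite -(card_imset _ supp_inj); apply: eq_card => A.
rewrite inE; apply/imsetP/idP => [[d]|hA].
  by rewrite inE => /eqP <- ->; rewrite weight_card.
have e : supp [ffun j => j \in A] = A by apply/setP => j; rewrite inE ffunE.
exists [ffun j => j \in A] => //; rewrite inE weight_card.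
by move: hA; rewrite -[in X in X -> _]e.
Qed.

Lemma weight_xorv_level (n w : nat) (x y : signvec n) (k : int) :
  n%:Z - (2 * w)%:Z = k -> (inner x y == k) = (weight (xorv x y) == w).
Proof. by move=> <-; rewrite inner_weight; apply/eqP/eqP; lia. Qed.

(** For x and w even, every y at distance w from x is even, so the restriction to even vectors loses
    nothing. *)
Lemma sum_even_level (V : nmodType) (n w : nat) (k : int) (F : signvec n -> V) (x :
  signvec n) :
  n%:Z - (2 * w)%:Z = k -> ~~ odd w -> x \in even_vec n ->
  \sum_(y in even_vec n | inner x y == k) F (xorv x y) = \sum_(d | weight d == w) F d.
Proof.
move=> hk ew xE; rewrite (reindex _ (onW_bij _ (xorv_bij x))) /=.
apply: eq_big => [d|d _]; last by rewrite xorvK.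
rewrite (weight_xorv_level _ _ hk) xorvK inE odd_weight_xorv.
move: xE; rewrite inE => /negPf ->.
by case: eqP => [->|_]; rewrite ?andbF// andbT.
Qed.

Lemma even_level_count (n w : nat) (k : int) :
  n%:Z - (2 * w)%:Z = k -> ~~ odd w ->
  (\sum_(x in even_vec n) \sum_(y in even_vec n | inner x y == k) 1 =
    #|even_vec n| * 'C(n, w))%N.
Proof.
move=> hk ew; rewrite -sum_nat_const; apply: eq_bigr => x xE.
rewrite (sum_even_level (fun=> 1%N) hk ew xE) sum1_card -card_weight.
by apply: eq_card => d; rewrite inE.
Qed.

Lemma even_vec_card_ge (n w : nat) : ~~ odd w -> ('C(n, w) <= #|even_vec n|)%N.
Proof.
move=> ew; rewrite -card_weight; apply: subset_leq_card; apply/fintype.subsetP => d.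
by rewrite !inE => /eqP ->.
Qed.

Lemma card_signvec (n : nat) : #|signvec n| = (2 ^ n)%N.
Proof. by rewrite card_ffun card_bool card_ord. Qed.

(** * Averaging over permutations of the coordinates *)

Definition permv (n : nat) (p : {perm 'I_n}) (x : signvec n) : signvec n :=
  [ffun j => x (p j)].

Lemma permvK (n : nat) (p : {perm 'I_n}) : cancel (permv p) (permv p^-1).
Proof. by move=> x; apply/ffunP => j; rewrite !ffunE permKV. Qed.

Lemma permvKV (n : nat) (p : {perm 'I_n}) : cancel (permv p^-1) (permv p).
Proof. by move=> x; apply/ffunP => j; rewrite !ffunE permK. Qed.

Lemma permv_bij (n : nat) (p : {perm 'I_n}) : bijective (permv p).
Proof. by exists (permv p^-1); [exact: permvK|exact: permvKV]. Qed.

Lemma permvM (n : nat) (p q : {perm 'I_n}) (x : signvec n) :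
  permv p (permv q x) = permv (p * q)%g x.
Proof. by apply/ffunP => j; rewrite !ffunE permM. Qed.

Lemma weight_permv (n : nat) (p : {perm 'I_n}) (x : signvec n) :
  weight (permv p x) = weight x.
Proof.
rewrite /weight [RHS](reindex_inj (@perm_inj _ p)).
by apply: eq_bigr => j _; rewrite ffunE.
Qed.

Lemma xorv_permv (n : nat) (p : {perm 'I_n}) (x y : signvec n) :
  xorv (permv p x) (permv p y) = permv p (xorv x y).
Proof. by apply/ffunP => j; rewrite !ffunE. Qed.

Lemma same_weight_permv (n : nat) (x y : signvec n) :
  weight x = weight y -> exists p, y = permv p x.
Proof.
move=> h; have : perm_eq [tuple y i | i < n] [tuple x i | i < n].
  have ct (z : signvec n) : count id [tuple z i | i < n] = weight z.
    rewrite -sum1_count big_tuple big_mkcond; apply: eq_bigr => j _.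
    by rewrite tnth_mktuple /=; case: (z j).
  apply/seq.permP => a.
  have e (z : seq bool) : count a z = (a true * count id z + a false * (size z - count id
    z))%N.
    elim: z => [|b z IH] /=; first by rewrite !muln0.
    by rewrite IH; have := count_size id z; case: b => /=; case: (a _) (a _) => -[]; lia.
  by rewrite !e !ct !size_tuple h.
move=> /tuple_permP[p e]; exists p; apply/ffunP => j; rewrite ffunE.
have : [tuple y i | i < n] = [tuple tnth [tuple x i | i < n] (p i) | i < n]
  by apply/val_inj.
by move=> /(congr1 (fun t => tnth t j)); rewrite !tnth_mktuple.
Qed.

(** The orbit of d0 is its whole weight class. Summing over the class and over the permutations in
    both orders gives the identity, written without division. *)
Lemma permv_average (R : realType) (n : nat) (G : signvec n -> R) (d0 : signvec n) :
  'C(n, weight d0)%:R * \sum_(p : {perm 'I_n}) G (permv p d0) =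
    n`!%:R * \sum_(d | weight d == weight d0) G d.
Proof.
transitivity (\sum_(d | weight d == weight d0) \sum_(p : {perm 'I_n}) G (permv p d)).
  rewrite [RHS](eq_bigr (fun=> \sum_(p : {perm 'I_n}) G (permv p d0))).
    rewrite sumr_const -card_weight mulr_natl.
    by congr (_ *+ _); apply: eq_card => d; rewrite inE.
  move=> d /eqP /esym hd; have [q ->] := same_weight_permv hd.
  rewrite [RHS](reindex_inj (mulIg q)); apply: eq_bigr => p _.
  by rewrite permvM.
rewrite exchange_big /= (eq_bigr (fun=> \sum_(d | weight d == weight d0) G d)).
  by rewrite sumr_const card_Sn mulr_natl.
move=> p _; rewrite [RHS](reindex _ (onW_bij _ (permv_bij p))) /=.
by apply: eq_bigl => d; rewrite weight_permv.
Qed.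

(* 'I_(t * n) is read as the matrix indices 'I_t * 'I_n, and each of the t rows of
   [dupv t x] is a copy of x. *)
Definition block_index (t n : nat) (i : 'I_(t * n)) : 'I_n :=
  (enum_val (cast_ord (esym (mxvec_cast t n)) i)).2.

Definition dupv (t n : nat) (x : signvec n) : signvec (t * n) :=
  [ffun i => x (block_index i)].

Lemma weight_dupv (t n : nat) (x : signvec n) : weight (dupv t x) = (t * weight x)%N.
Proof.
rewrite /weight (reindex _ (curry_mxvec_bij t n)) /=.
rewrite (eq_bigr (fun ij : 'I_t * 'I_n => x ij.2 : nat)).
  rewrite -(pair_bigA _ (fun (i : 'I_t) j => x j : nat)) /=.
  by rewrite sum_nat_const card_ord.
by move=> [i j] _; rewrite ffunE /block_index /= /mxvec_index cast_ordK enum_rankK.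
Qed.

Lemma xorv_dupv (t n : nat) (x y : signvec n) :
  xorv (dupv t x) (dupv t y) = dupv t (xorv x y).
Proof. by apply/ffunP => j; rewrite !ffunE. Qed.

(** * Averaging over the coins *)

Definition event_combination (R : realType) (T : Type) (I : finType) (E : I -> set T)
    (c : I -> R) (w : T) : \bar R :=
  (\sum_(i : I) (c i)%:E * (\1_(E i) w)%:E)%E.

Lemma measurable_event_combination (R : realType) (d : measure_display)
    (T : measurableType d) (I : finType) (E : I -> set T) (c : I -> R) :
  (forall i, measurable (E i)) -> measurable_fun setT (event_combination E c).
Proof.
move=> mE; apply: emeasurable_sum => i; apply: measurable_funeM.
by apply/measurable_EFinP; exact: measurable_indic.
Qed.

Lemma event_combination_ge0 (R : realType) (T : Type) (I : finType) (E : I -> set T)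
    (c : I -> R) : (forall i, 0 <= c i) -> forall w, (0 <= event_combination E c w)%E.
Proof. by move=> c0 w; apply: sume_ge0 => i _; rewrite mule_ge0 ?lee_fin. Qed.

Lemma integral_event_combination (R : realType) (d : measure_display)
    (T : measurableType d) (P : probability T R) (I : finType) (E : I -> set T)
    (c : I -> R) :
  (forall i, measurable (E i)) -> (forall i, 0 <= c i) ->
  (\int[P]_w event_combination E c w = (\sum_(i : I) c i * fine (P (E i)))%:E)%E.
Proof.
move=> mE c0; rewrite ge0_integral_sum//.
- rewrite -sumEFin; apply: eq_bigr => i _.
  rewrite ge0_integralZl_EFin//.
    by rewrite integral_indic// setIT EFinM fineK// fin_num_measure.
  by apply/measurable_EFinP; exact: measurable_indic.
- move=> i; apply: measurable_funeM.
  by apply/measurable_EFinP; exact: measurable_indic.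
- by move=> i w _; rewrite mule_ge0 ?lee_fin.
Qed.

(** The inequality valid for each outcome of the coins is integrated. Keeping a and b on separate
    sides makes all integrands nonnegative. *)
Lemma le_prob_combination (R : realType) (d : measure_display) (T : measurableType d)
    (P : probability T R) (I : finType) (E : I -> set T) (a b : I -> R) (K : R) :
  (forall i, measurable (E i)) ->
  (forall i, 0 <= a i) -> (forall i, 0 <= b i) -> 0 <= K ->
  (forall w, \sum_(i : I) a i * \1_(E i) w <= \sum_(i : I) b i * \1_(E i) w + K) ->
  \sum_(i : I) a i * fine (P (E i)) <= \sum_(i : I) b i * fine (P (E i)) + K.
Proof.
move=> mE a0 b0 K0 h; rewrite -lee_fin EFinD -!integral_event_combination//.
have -> : K%:E = (\int[P]_w (cst K%:E) w)%E.
  by rewrite integral_cst//= probability_setT mule1.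
have mC c : measurable_fun setT (event_combination E c).
  exact: measurable_event_combination.
rewrite -ge0_integralD//.
- apply: ge0_le_integral => //.
  + by move=> w _; exact: event_combination_ge0.
  + exact: emeasurable_funD.
  + move=> w _ /=.
    have e (c : I -> R) : event_combination E c w = (\sum_(i : I) c i * \1_(E i) w)%:E.
      by rewrite -sumEFin; apply: eq_bigr => i _; rewrite EFinM.
    by rewrite !e -EFinD lee_fin.
- by move=> w _; exact: event_combination_ge0.
Qed.

(** * Random embedding and transfer between levels *)

Lemma xorvC (n : nat) (x y : signvec n) : xorv x y = xorv y x.
Proof. by apply/ffunP => j; rewrite !ffunE addbC. Qed.

Lemma xorv_cancel (n : nat) (z x y : signvec n) :
  xorv (xorv z x) (xorv z y) = xorv x y.
Proof. by apply/ffunP => j; rewrite !ffunE; case: (z j) (x j) (y j) => -[] []. Qed.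

(** Both parties use the same g, so the inner product of the images is exactly t times that of the
    inputs. *)
Definition rand_embed (t n : nat) (g : {perm 'I_(t * n)} * signvec (t * n))
    (x : signvec n) : signvec (t * n) :=
  xorv g.2 (permv g.1 (dupv t x)).

(** The random signs make the first image uniform, and the permutation makes the difference of the
    two images uniform in its weight class. So the pair of images is uniform on its level. *)
Lemma sum_rand_embed (R : realType) (t n : nat) (x y : signvec n)
    (F : signvec (t * n) -> signvec (t * n) -> R) (w := weight (xorv x y)) :
  'C(t * n, t * w)%:R * \sum_g F (rand_embed g x) (rand_embed g y) =
  (t * n)`!%:R *
    \sum_(X : signvec (t * n)) \sum_(Y | weight (xorv X Y) == (t * w)%N) F X Y.
Proof.
pose G d := \sum_(s : signvec (t * n)) F s (xorv s d).
have -> : \sum_g F (rand_embed g x) (rand_embed g y) =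
    \sum_(p : {perm 'I_(t * n)}) G (permv p (dupv t (xorv x y))).
  rewrite -(pair_bigA _ (fun p s => F (rand_embed (p, s) x) (rand_embed (p, s) y))) /=.
  apply: eq_bigr => p _; rewrite /G.
  rewrite [RHS](reindex _ (onW_bij _ (xorv_bij (permv p (dupv t x))))) /=.
  apply: eq_bigr => s _; rewrite /rand_embed /= -xorv_dupv -xorv_permv.
  by congr F; [exact: xorvC|rewrite xorv_cancel].
have <- : weight (dupv t (xorv x y)) = (t * w)%N by rewrite weight_dupv.
rewrite permv_average; congr (_ * _); rewrite exchange_big /=.
apply: eq_bigr => X _; rewrite [RHS](reindex _ (onW_bij _ (xorv_bij X))) /=.
by apply: eq_bigl => d; rewrite xorvK.
Qed.

Definition level_sum (R : realType) (n : nat) (k : int) (F : signvec n -> signvec n -> R)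
  : R :=
  \sum_(X : signvec n) \sum_(Y | inner X Y == k) F X Y.

Lemma card_rand_embed (t n : nat) :
  #|{: {perm 'I_(t * n)} * signvec (t * n)}| = ((t * n)`! * 2 ^ (t * n))%N.
Proof. by rewrite card_prod card_Sn card_signvec. Qed.

(** Averaging the hypothesis over g replaces the pairs of even vectors at levels k and - k by
    uniform pairs at levels t k and - t k. Both levels get the same normalization by the symmetry of
    binomial coefficients. *)
Lemma transfer (R : realType) (t n w k : nat) (K : R)
    (F : signvec (t * n) -> signvec (t * n) -> R) :
  n = (2 * w + k)%N -> ~~ odd w -> ~~ odd n -> 
  (forall g, \sum_(x in even_vec n) \sum_(y in even_vec n)
      gap_sign R k x y * F (rand_embed g x) (rand_embed g y) <= K) ->
  (#|even_vec n| * 'C(n, w))%:R *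
    (level_sum (t * k)%:Z F - level_sum (- (t * k)%:Z) F) <=
  'C(t * n, t * w)%:R * 2 ^+ (t * n) * K.
Proof.
move=> nE ew en H.
have sumE (l : int) (v : nat) : n%:Z - (2 * v)%:Z = l -> ~~ odd v ->
    'C(t * n, t * v)%:R * \sum_g \sum_(x in even_vec n) \sum_(y in even_vec n | inner x y
      == l)
      F (rand_embed g x) (rand_embed g y) =
    (t * n)`!%:R * ((#|even_vec n| * 'C(n, v))%:R * level_sum (t%:Z * l) F).
  move=> hl ev.
  rewrite exchange_big /=; under eq_bigr do rewrite exchange_big /=.
  rewrite mulr_sumr mulrCA -(even_level_count hl ev) natr_sum mulr_suml.
  apply: eq_bigr => x _; rewrite mulr_sumr natr_sum mulr_suml;
    apply: eq_bigr => y /andP[_].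
  rewrite (weight_xorv_level _ _ hl) => /eqP wE.
  rewrite mul1r -wE sum_rand_embed wE; congr (_ * _); apply: eq_bigr => X _.
  apply: eq_bigl => Y; rewrite (@weight_xorv_level _ (t * v)) //.
  by rewrite -hl !PoszM mulrBr mulrCA.
(* Level - k corresponds to distance n - w, which is even since n and w are. *)
have h1 := sumE k%:Z w; have h2 := sumE (- k%:Z) (n - w)%N.
have {}h1 := h1 ltac:(lia) ew.
have {}h2 := h2 ltac:(lia) ltac:(by rewrite oddB; [rewrite (negPf en) (negPf ew)|lia]).
rewrite bin_sub ?mulnBr ?bin_sub in h2; [|by rewrite leq_mul2l; apply/orP; right;
  lia|lia].
have fact0 : 0 < (t * n)`!%:R :> R by rewrite ltr0n fact_gt0.
have -> : - (t * k)%:Z = t%:Z * - k%:Z by rewrite PoszM mulrN.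
rewrite -(ler_pM2l fact0) mulrBr mulrBr PoszM -h1 -h2 -mulrBr -!mulrA mulrCA.
apply: ler_wpM2l; first exact: ler0n.
rewrite -sumrB -natrX mulrA -natrM -card_rand_embed -sum1_card natr_sum mulr_suml.
apply: ler_sum => g _; rewrite mul1r; apply: le_trans (H g).
rewrite -sumrB; apply: ler_sum => x _; rewrite le_eqVlt; apply/orP; left; apply/eqP.
rewrite !big_mkcondr -sumrB; apply: eq_bigr => y _ /=.
by rewrite /gap_sign; do 2 case: (_ == _) => /=;
  rewrite ?subr0 ?sub0r ?subrr ?mul1r ?mulN1r ?mul0r.
Qed.

(** * The lower bound *)

Definition accept_prob (R : realType) (d : measure_display) (T : measurableType d)
    (P : probability T R) (X Y : Type) (p : rprotocol T X Y (option bool))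
    (x : X) (y : Y) : R :=
  fine (P [set w : T | output (p w) x y = Some true]).

(** For fixed coins the protocol is deterministic and [protocol_discrepancy] applies; the bound is
    then integrated. The tests a and b provide the nonnegative coefficients that
    [le_prob_combination] asks for. *)
Lemma accept_prob_discrepancy (R : realType) (d : measure_display)
    (T : measurableType d) (P : probability T R) (S : finType) (X Y : Type)
    (p : rprotocol T X Y (option bool)) (ax : S -> X) (ay : S -> Y)
    (a b : S -> S -> bool) (E : {set S}) (delta eta : R) (D : nat) :
  0 <= delta -> 0 <= eta ->
  (forall A B : {set S}, A \subset E -> B \subset E ->
    `|\sum_(x in A) \sum_(y in B) ((a x y)%:R - (b x y)%:R)| <=
      delta * (#|A|%:R * #|B|%:R) + eta) ->
  (forall w x y, (bits (p w) x y <= D)%N) ->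
  \sum_(x in E) \sum_(y in E)
      ((a x y)%:R - (b x y)%:R) * accept_prob P p (ax x) (ay y) <=
    delta * (#|E|%:R * #|E|%:R) + 2 ^+ D * eta.
Proof.
move=> delta0 eta0 H hD.
pose c (f : S -> S -> bool) (i : S * S) : R :=
  if (i.1 \in E) && (i.2 \in E) then (f i.1 i.2)%:R else 0.
have c0 f i : 0 <= c f i by rewrite /c; case: ifP.
have conv (F : S -> S -> R) :
    \sum_(x in E) \sum_(y in E) ((a x y)%:R - (b x y)%:R) * F x y =
    \sum_i c a i * F i.1 i.2 - \sum_i c b i * F i.1 i.2.
  rewrite pair_big /= big_mkcond /= -sumrB; apply: eq_bigr => i _.
  by rewrite /c; case: ifP => _; rewrite ?mul0r ?subrr ?mulrBl.
pose Ev (i : S * S) := [set w : T | output (p w) (ax i.1) (ay i.2) = Some true].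
have mEv i : measurable (Ev i) by exact: rp_measurable.
rewrite (conv (fun x y => accept_prob P p (ax x) (ay y))) lerBlDl.
set K := _ + _ * eta.
have K0 : 0 <= K by rewrite addr_ge0 ?mulr_ge0 ?exprn_ge0.
apply: (@le_prob_combination R d T P _ Ev) => // w.
rewrite -lerBlDl -(conv (fun x y => \1_(Ev (x, y)) w)).
apply: le_trans (ler_norm _) _.
have := @protocol_discrepancy R S X Y (option bool) ax ay
  (fun x y => (a x y)%:R - (b x y)%:R) E delta eta eta0 H delta0
  (fun z => z == Some true) (p w) D E E (subxx _) (subxx _) (fun x y _ _ => hD w _ _).
apply: le_trans; rewrite le_eqVlt; apply/orP; left; apply/eqP.
congr `| _ |; apply: eq_bigr => x _; rewrite big_mkcondr; apply: eq_bigr => y _.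
rewrite indicE; have -> : (w \in Ev (x, y)) = (output (p w) (ax x) (ay y) == Some true).
  by apply/idP/eqP; rewrite inE.
by case: eqP => _; rewrite ?mulr1 ?mulr0.
Qed.

Lemma level_count (R : realType) (n w : nat) (k : int) : n%:Z - (2 * w)%:Z = k ->
  level_sum k (fun _ _ : signvec n => 1 : R) = 2 ^+ n * 'C(n, w)%:R.
Proof.
move=> hk; rewrite /level_sum (eq_bigr (fun=> 'C(n, w)%:R)).
  by rewrite sumr_const card_signvec -[_ *+ (2 ^ n)]mulr_natl natrX.
move=> x _; rewrite (reindex _ (onW_bij _ (xorv_bij x))) /=.
rewrite (eq_bigl (fun y => weight y == w)).
  by rewrite sumr_const -card_weight; congr _%:R; apply: eq_card => y; rewrite inE.
by move=> y; rewrite (weight_xorv_level _ _ hk) xorvK.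
Qed.

Lemma card_U_supp (R : realType) (n k : nat) : (0 < k)%N ->
  #|U_supp n k|%:R = level_sum k%:Z (fun _ _ : signvec n => 1) +
                     level_sum (- k%:Z) (fun _ _ : signvec n => 1) :> R.
Proof.
move=> k0; rewrite -sum1_card natr_sum big_mkcond /=.
rewrite (eq_bigr (fun i : signvec n * signvec n =>
  if (i.1, i.2) \in U_supp n k then 1 else 0)); last by case.
rewrite -(pair_bigA _ (fun x y => if (x, y) \in U_supp n k then 1 else 0)) /=.
rewrite -big_split /=; apply: eq_bigr => x _.
rewrite [X in _ = X + _]big_mkcond [X in _ = _ + X]big_mkcond -big_split.
apply: eq_bigr => y _ /=; rewrite inE /=.
case: eqP => [->|_] /=; last by case: eqP => _; rewrite ?add0r.
by rewrite ifF ?addr0//; apply/eqP; lia.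
Qed.

(** Each level holds L pairs, so success 2 / 3 means that acceptance at k plus rejection at - k is
    at least 4 L / 3. Rejection is at most L minus acceptance, which leaves a gap of L / 3. *)
Lemma success_prob_gap (R : realType) (d : measure_display) (T : measurableType d)
    (P : probability T R) (n k w : nat)
    (p : rprotocol T (signvec n) (signvec n) (option bool)) :
  (0 < k)%N -> n = (2 * w + k)%N -> 2 / 3 <= success_prob P k p ->
  2 ^+ n * 'C(n, w)%:R / 3 <=
    level_sum k%:Z (accept_prob P p) - level_sum (- k%:Z) (accept_prob P p).
Proof.
move=> k0 nE; set L := 2 ^+ n * _.
have L0 : 0 < L by rewrite mulr_gt0 ?exprn_gt0// ltr0n bin_gt0 nE; lia.
have cp : level_sum k%:Z (fun _ _ : signvec n => 1) = L :> R by apply: level_count; lia.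
have cn : level_sum (- k%:Z) (fun _ _ : signvec n => 1) = L :> R.
  rewrite (@level_count _ _ (n - w)); last lia.
  by rewrite bin_sub//; lia.
have cU : #|U_supp n k|%:R = 2 * L by rewrite (card_U_supp R n k0) cp cn; lra.
(* Only an inequality, since the protocol may also output [None]. *)
have mono : \sum_(x : signvec n) \sum_(y | inner x y == - k%:Z)
     fine (P [set t : T | output (p t) x y = Some false]) <=
     L - level_sum (- k%:Z) (accept_prob P p).
  rewrite -cn /level_sum -sumrB; apply: ler_sum => x _; rewrite -sumrB.
  apply: ler_sum => y _; rewrite lerBrDr /accept_prob -lee_fin EFinD !fineK
    ?fin_num_measure//;
    try exact: rp_measurable.
  rewrite -measureU; [|exact: rp_measurable|exact: rp_measurable|].
    by apply: probability_le1; apply: measurableU; exact: rp_measurable.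
  by apply/seteqP; split => t //= [-> ].
have -> : success_prob P k p = (2 * L)^-1 * (level_sum k%:Z (accept_prob P p) +
    \sum_(x : signvec n) \sum_(y | inner x y == - k%:Z)
     fine (P [set t : T | output (p t) x y = Some false])).
  rewrite /success_prob (eq_bigr (fun i : signvec n * signvec n => U_pmf R k (i.1, i.2) *
     fine (P [set t : T | output (p t) i.1 i.2 = EGH k i.1 i.2]))); last by case.
  rewrite -(pair_bigA _ (fun x y => U_pmf R k (x, y) *
     fine (P [set t : T | output (p t) x y = EGH k x y]))) /=.
  rewrite -big_split mulr_sumr; apply: eq_bigr => x _ /=.
  rewrite [X in _ = _ * (X + _)]big_mkcond [X in _ = _ * (_ + X)]big_mkcond -big_split
    mulr_sumr.
  apply: eq_bigr => y _ /=; rewrite /U_pmf cU inE /= /EGH.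
  have [e|e] /= := eqVneq (inner x y) k%:Z.
    by rewrite e (_ : (k%:Z == - k%:Z) = false) ?addr0//; apply/negbTE/eqP; lia.
  by have [e'|e'] /= := eqVneq (inner x y) (- k%:Z); rewrite ?add0r ?mul0r ?mulr0.
by clearbody L; rewrite ler_pdivlMl ?mulr_gt0//; lra.
Qed.

(** Each of the two error terms gets half of the advantage 1 / 3. *)
Lemma main_arithmetic (R : realType) (r s C E : nat) (v := (r * s)%N) (n := (4 * (4 * v ^
  2))%N) :
  (2 * (24 * (24 * 24)) <= r)%N -> (0 < s)%N -> (2 ^ n <= 16 * v * C)%N -> (0 < C)%N ->
  (C <= E)%N -> (E <= 2 ^ n)%N ->
  16 * (32 * (9 * (s%:R / n%:R))) * (E%:R * E%:R) + 2 ^+ (v ^ 2) * (18 / 5) ^+ n <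
    (E * C)%:R / 3 :> R.
Proof.
move=> hr s0 hn C0 CE En.
have r0 : (0 < r)%N by lia.
have v0 : (0 < v)%N by rewrite muln_gt0 r0.
have vR : 0 < v%:R :> R by rewrite ltr0n.
have hnR : 2 ^+ n <= 16 * v%:R * C%:R :> R by rewrite -natrX -!natrM ler_nat.
have nR : n%:R = 16 * v%:R ^+ 2 :> R.
  by rewrite -natrX -natrM; congr _%:R; rewrite /n; lia.
(* With E <= 2 ^ n <= 16 v C and n = 16 v^2, the term is at most 16 * 32 * 9 * E C / r; the bound on
   r is 6 * 16 * 32 * 9 = 2 * 24^3. *)
have part1 : 16 * (32 * (9 * (s%:R / n%:R))) * (E%:R * E%:R) <= (E * C)%:R / 6 :> R.
  have e1 : E%:R <= 16 * v%:R * C%:R :> R by apply: le_trans hnR; rewrite -natrX ler_nat.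
  have e2 : 0 <= s%:R / n%:R :> R by rewrite divr_ge0.
  have h1 : s%:R / n%:R * E%:R <= s%:R / v%:R * C%:R :> R.
    apply: le_trans (ler_wpM2l e2 e1) _; rewrite nR le_eqVlt; apply/orP; left; apply/eqP.
    by field; rewrite gt_eqF.
  have h2 : s%:R / v%:R = r%:R^-1 :> R.
    by rewrite /v natrM; field; rewrite !gt_eqF ?ltr0n.
  have h3 : 2 * (24 * (24 * 24)) * r%:R^-1 <= 1 :> R.
    by rewrite ler_pdivrMr ?ltr0n// mul1r -!natrM ler_nat.
  have E0 : 0 <= E%:R :> R by exact: ler0n.
  have h4 : 2 * (24 * (24 * 24)) * r%:R^-1 * C%:R <= C%:R :> R.
    by rewrite -[leRHS]mul1r ler_wpM2r.
  rewrite h2 in h1; have := ler_wpM2l E0 h1; have := ler_wpM2l E0 h4.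
  rewrite natrM; move: (s%:R / n%:R) (r%:R^-1 : R) (C%:R : R) (E%:R : R);
    clear => x y z e.
  lra.
(* As (9 / 10) ^ 16 <= 1 / 4 and n = 16 v^2, the gain of (18 / 5) ^ n over 4 ^ n outweighs the 2 ^
   (v^2) leaves and still leaves a factor 2 ^ (- v^2). *)
have part2 : 2 ^+ (v ^ 2) * (18 / 5) ^+ n < (E * C)%:R / 6 :> R.
  have q0 : (9 / 10) ^+ 16 <= 1 / 4 :> R.
    have q1 : (9 / 10) ^+ 4 <= 2 / 3 :> R by lra.
    rewrite (_ : 16 = 4 * 4)%N// exprM; apply: (@le_trans _ _ ((2 / 3) ^+ 4)); last lra.
    by rewrite lerXn2r// nnegrE ?exprn_ge0// divr_ge0.
  have nE : n = (16 * v ^ 2)%N by rewrite /n; lia.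
  have -> : (18 / 5) ^+ n = 2 ^+ n * 2 ^+ n * (9 / 10) ^+ n :> R.
    by rewrite -!exprMn; congr (_ ^+ _); lra.
  have k1 : (9 / 10) ^+ n <= (1 / 4) ^+ (v ^ 2) :> R.
    by rewrite nE exprM lerXn2r// nnegrE ?exprn_ge0 ?divr_ge0.
  have k2 : 2 ^+ (v ^ 2) * (1 / 4) ^+ (v ^ 2) = (2 ^ (v ^ 2))%:R^-1 :> R.
    by rewrite -exprMn natrX -exprVn; congr (_ ^+ _); lra.
  have k3 : (6 * (16 * 16) * v ^ 2 < 2 ^ (v ^ 2))%N.
    have v3 : (v ^ 3 < 2 ^ (v ^ 2))%N.
      apply: (@leq_trans ((2 ^ v) ^ 3)); first by rewrite ltn_exp2r// ltn_expl.
      rewrite -expnM leq_exp2l// expnS expn1 leq_mul2l; apply/orP; right.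
      by rewrite /v; nia.
    apply: leq_ltn_trans v3; rewrite [(v ^ 3)%N]expnS leq_mul2r; apply/orP; right.
    by rewrite /v; nia.
  set Y := 2 ^+ n in hnR *.
  have Y0 : 0 <= Y by rewrite exprn_ge0.
  apply: (@le_lt_trans _ _ (Y * Y * (2 ^ (v ^ 2))%:R^-1)).
    rewrite mulrCA -k2 ler_wpM2l ?mulr_ge0// ler_wpM2l// exprn_ge0//.
  rewrite ltr_pdivrMr ?ltr0n ?expn_gt0//.
  apply: (@le_lt_trans _ _ ((16 * v%:R * C%:R) * (16 * v%:R * C%:R))).
    by apply: ler_pM.
  have -> : 16 * v%:R * C%:R * (16 * v%:R * C%:R) =
      (C * C)%:R / 6 * (6 * (16 * 16) * v ^ 2)%:R :> R.
    rewrite [(C * C)%:R]natrM [(_ * v ^ 2)%:R]natrM [(v ^ 2)%:R]natrX.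
    by rewrite [(6 * _)%:R]natrM [(16 * 16)%:R]natrM; field.
  apply: (@lt_le_trans _ _ ((C * C)%:R / 6 * (2 ^ (v ^ 2))%:R)).
    by rewrite ltr_pM2l ?ltr_nat// divr_gt0// ltr0n muln_gt0 C0.
  by rewrite ler_wpM2r// ler_wpM2r ?invr_ge0// ler_nat leq_mul2r CE orbT.
by move: part1 part2; lra.
Qed.

(** The original level is 4 s in dimension n = 16 v^2. After t = r^2 repetitions it is 4 r^2 s in
    dimension (4 r^2 s)^2, exactly the square root. A protocol within v^2 bits would contradict
    [main_arithmetic]. *)
Lemma protocol_bits_gt (R : realType) (r s : nat) (v := (r * s)%N)
    (n := (4 * (4 * v ^ 2))%N) (t := (r ^ 2)%N)
    (d : measure_display) (T : measurableType d) (P : probability T R)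
    (p : rprotocol T (signvec (t * n)) (signvec (t * n)) (option bool)) :
  (2 * (24 * (24 * 24)) <= r)%N -> (0 < s)%N ->
  2 / 3 <= success_prob P (t * (4 * s)) p ->
  exists w x y, (v ^ 2 < bits (p w) x y)%N.
Proof.
move=> hr s0 success; apply: contrapT => no.
have hD w x y : (bits (p w) x y <= v ^ 2)%N.
  by rewrite leqNgt; apply/negP => h; apply: no; exists w, x, y.
have r0 : (0 < r)%N by lia.
have v0 : (0 < v)%N by rewrite muln_gt0 r0.
have sv : (s <= v)%N by rewrite /v leq_pmull.
have vv : (v <= v ^ 2)%N by rewrite expnS expn1 leq_pmulr.
(* The even distance that corresponds to the inner product 4 s in dimension 16 v^2. *)
set w := (8 * v ^ 2 - 2 * s)%N.
have nE : n = (2 * w + 4 * s)%N by rewrite /w /n; lia.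
have ew : ~~ odd w.
  by rewrite /w oddB ?oddM//; lia.
have en : ~~ odd n by rewrite /n oddM.
have t0 : (0 < t)%N by rewrite expn_gt0 r0.
have tk0 : (0 < t * (4 * s))%N by rewrite muln_gt0 t0 muln_gt0.
have tnE : (t * n = 2 * (t * w) + t * (4 * s))%N by rewrite mulnCA -mulnDr -nE.
have gap := @success_prob_gap R d T P (t * n) (t * (4 * s)) (t * w) p tk0 tnE success.
pose delta : R := 16 * (32 * (9 * (s%:R / n%:R))).
pose eta : R := (18 / 5) ^+ n.
pose E := even_vec n.
have delta0 : 0 <= delta by do 3 rewrite mulr_ge0//; rewrite divr_ge0.
have eta0 : 0 <= eta by rewrite exprn_ge0// divr_ge0.
pose K := delta * (#|E|%:R * #|E|%:R) + 2 ^+ (v ^ 2) * eta.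
have HK (g : {perm 'I_(t * n)} * signvec (t * n)) :
    \sum_(x in E) \sum_(y in E)
      gap_sign R (4 * s) x y * accept_prob P p (rand_embed g x) (rand_embed g y) <= K.
  apply: (@accept_prob_discrepancy R d T P _ _ _ p (rand_embed g) (rand_embed g)
    (fun x y => inner x y == (4 * s)%:Z) (fun x y => inner x y == - (4 * s)%:Z)) => //.
  move=> A B AE BE; apply: discrepancy => [||x y xA yB].
  - by rewrite /n; lia.
  - by rewrite /n; lia.
  - by apply: inner_even_vec; [exact: (fintype.subsetP AE)|exact: (fintype.subsetP BE)].
have tr := transfer nE ew en HK.
set C := 'C(n, w) in tr.
have C0 : (0 < C)%N by rewrite bin_gt0 nE; lia.
have CE : (C <= #|E|)%N by apply: even_vec_card_ge.
have E2 : (#|E| <= 2 ^ n)%N by rewrite -card_signvec max_card.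
have near : (2 ^ n <= 16 * v * C)%N.
  have := near_center_bin_ge r0 s0; rewrite -/v -/w /C.
  by have -> : (16 * v ^ 2 = n)%N by rewrite /n; lia.
have fin := main_arithmetic R hr s0 near C0 CE E2.
rewrite -/v -/n -/delta -/eta -/K in fin.
set L := _ - _ in gap tr.
have B0 : 0 < 'C(t * n, t * w)%:R * 2 ^+ (t * n) :> R.
  by rewrite mulr_gt0 ?exprn_gt0// ltr0n bin_gt0 leq_mul2l; apply/orP; right; rewrite nE;
    lia.
have : 'C(t * n, t * w)%:R * 2 ^+ (t * n) * ((#|E| * C)%:R / 3) <=
       'C(t * n, t * w)%:R * 2 ^+ (t * n) * K.
  apply: le_trans tr; apply: le_trans (ler_wpM2l (ler0n R (#|E| * C)) gap).
  by rewrite le_eqVlt; apply/orP; left; apply/eqP; ring.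
by rewrite ler_pM2l// leNgt fin.
Qed.

Lemma U_supp_neq0 (n k w : nat) : (0 < k)%N -> n = (2 * w + k)%N ->
  U_supp n k != finset.set0.
Proof.
move=> k0 nE; apply/finset.set0Pn.
have : (0 < #|[set x : signvec n | weight x == w]%SET|)%N.
  by rewrite card_weight bin_gt0 nE; lia.
move=> /card_gt0P[x]; rewrite inE => /eqP xw.
exists ([ffun=> false], x); rewrite inE /=; apply/orP; left.
rewrite (@weight_xorv_level _ w) -?xw; last by rewrite xw; lia.
by apply/eqP; congr weight; apply/ffunP => j; rewrite !ffunE.
Qed.

Lemma ceil_sqrt_sqr (R : realType) (k : nat) : ceil_sqrt R (k ^ 2) = k.
Proof.
rewrite /ceil_sqrt natrX sqrtr_sqr ger0_norm//.
by rewrite -[k%:R]/(k%:Z%:~R) intrKceil.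
Qed.

Theorem theorem5 (R : realType) :
  exists alpha : R, 0 < alpha /\
    infinite_set [set n : nat |
      [/\ (0 < n)%N,
          U_supp n (ceil_sqrt R n) != finset.set0 &
          forall (d : measure_display) (T : measurableType d)
              (P : probability T R)
              (p : rprotocol T (signvec n) (signvec n) (option bool)),
            2 / 3 <= success_prob P (ceil_sqrt R n) p ->
            ((alpha * n%:R)%:E <= comm_complexity R p)%E]].
Proof.
(* The smallest value allowed by [main_arithmetic]; afterwards only positivity and this bound on r
   are used. *)
pose r := (2 * (24 * (24 * 24)))%N.
have : (2 * (24 * (24 * 24)) <= r)%N by [].
have : (0 < r)%N by rewrite !muln_gt0.
clearbody r => r0 hr.
have rR : 0 < r%:R :> R by rewrite ltr0n.
(* The ratio of the v^2 bits to the length r^2 * 16 v^2. *)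
exists (16 * r%:R ^+ 2)^-1; split; first by rewrite invr_gt0 mulr_gt0// exprn_gt0.
(* These lengths are perfect squares, so the rounding in the ceiling of the square root is void. *)
pose size s := (r ^ 2 * (4 * (4 * (r * s) ^ 2)))%N.
have sizeE s : size s = ((r ^ 2 * (4 * s)) ^ 2)%N.
  by rewrite /size !expnMn; lia.
have size_inj : injective (fun s => size s.+1).
  move=> s s' /eqP; rewrite !sizeE eqn_sqr eqn_pmul2l ?expn_gt0 ?r0//.
  by rewrite eqn_pmul2l// => /eqP[].
(* If the set of lengths were finite, so would be its preimage under the injective [size], yet that
   preimage is all of nat. The shift to s + 1 keeps s positive. *)
move=> fin; apply: infinite_nat.
suff -> : [set: nat] = (fun s => size s.+1) @^-1` [set n : nat |
      [/\ (0 < n)%N,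
          U_supp n (ceil_sqrt R n) != finset.set0 &
          forall (d : measure_display) (T : measurableType d)
              (P : probability T R)
              (p : rprotocol T (signvec n) (signvec n) (option bool)),
            2 / 3 <= success_prob P (ceil_sqrt R n) p ->
            (((16 * r%:R ^+ 2)^-1 * n%:R)%:E <= comm_complexity R p)%E]].
  by apply: finite_preimage fin => ? ? _ _; exact: size_inj.
apply/seteqP; split => // i _ /=.
have ceilE : ceil_sqrt R (size i.+1) = (r ^ 2 * (4 * i.+1))%N
  by rewrite sizeE ceil_sqrt_sqr.
have k0 : (0 < r ^ 2 * (4 * i.+1))%N by rewrite muln_gt0 expn_gt0 r0.
have ri : (i.+1 <= (r * i.+1) ^ 2)%N.
  apply: (@leq_trans (r * i.+1)); first by rewrite leq_pmull.
  by rewrite expnS expn1 leq_pmulr// muln_gt0 r0.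
split.
- by rewrite sizeE expn_gt0 k0.
- rewrite ceilE; apply: (@U_supp_neq0 _ _ (r ^ 2 * (8 * (r * i.+1) ^ 2 - 2 * i.+1))) =>
  //.
  by rewrite /size (mulnCA 2) -mulnDr; congr (_ * _)%N; lia.
move=> d T P p; rewrite ceilE => success.
have [w [x [y bit]]] := protocol_bits_gt hr (ltn0Sn i) success.
apply: (@le_trans _ _ ((bits (p w) x y)%:R%:E)); last first.
  by apply: ereal_sup_ubound; exists w, x, y.
rewrite lee_fin ler_pdivrMl ?mulr_gt0 ?exprn_gt0//.
rewrite -natrX -!natrM ler_nat; apply: (@leq_trans (16 * r ^ 2 * (r * i.+1) ^ 2)).
  by rewrite /size; lia.
by rewrite leq_mul2l ltnW// orbT.
Qed.
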